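(* Let $F,G,H:\mathbb{C}^{\bullet}\times\mathbb{C}\to\mathbb{D}$ be difunctors of double categories, let $\alpha$ be a dinatural transformation from $F$ to $G$, and let $\beta:G\overset{\bullet}{\to}H$ be a natural transformation. Then there is a dinatural transformation $\alpha\odot\beta$ from $F$ to $H$ (called their composite) with components: - for each object $A$ of $\mathbb{C}$: $(\alpha\odot\beta)A := \alpha A\odot\beta(A,A)$; - for each arrow $f$ of $\mathbb{C}$: $(\alpha\odot\beta)f := \alpha f\odot\beta(f,f)$; - for each proarrow $m:A\overset{\bullet}{\to}B$ of $\mathbb{C}$, the disk $(\alpha\odot\beta)m$ given, up to coherators, by $$\big(F(B,m)\odot\alpha B\odot\beta(m,B)^{-1}\big)\cdot\big(\alpha m\odot\beta(A,B)\big)\cdot\big(F(m,A)\odot\alpha A\odot\beta(A,m)\big),$$ which goes from $F(B,m)\odot\alpha B\odot\beta(B,B)\odot H(m,B)$ to $F(m,A)\odot\alpha A\odot\beta(A,A)\odot H(A,m)$.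
   Context: **Double categories.** A (weak) double category $\mathbb{C}$ has objects, arrows $f : A \to B$, proarrows $m : A \overset{\bullet}{\to} B$, and squares. A square $\varphi$ has a left proarrow $m : A \overset{\bullet}{\to} C$, a right proarrow $n : B \overset{\bullet}{\to} D$, a top arrow $f : A \to B$ and a bottom arrow $g : C \to D$. All composites are written in left-to-right (diagrammatic) order. Arrow-dimension composition, written $\cdot$ with units $\mathrm{id}$, composes arrows, and composes squares horizontally ($\varphi\cdot\psi$ is defined when the right proarrow of $\varphi$ is the left proarrow of $\psi$); it is strictly associative and unital. Proarrow-dimension composition, written $\odot$ with units $\mathrm{U}$, composes proarrows, and composes squares vertically ($\varphi\odot\psi$ is defined when the bottom arrow of $\varphi$ is the top arrow of $\psi$); it is associative and unital only up to coherent isomorphism. A proarrow disk $m \to n$ is a square with left proarrow $m$, right proarrow $n$, and identity top and bottom arrows; it is invertible if it has a two-sided inverse for $\cdot$. Associators and unitors for $\odot$ are suppressed, as are bracketings; an equation that holds after inserting the appropriate coherators is written with $\cong$ instead of $=$. Dimensional promotion: a lower-dimensional cell appearing where a higher-dimensional one is expected denotes the corresponding identity (e.g. in $F(A,m)$ with $A$ an object and $m$ a proarrow, $A$ stands for $\mathrm{U}_A$; in $F(g,\varphi)$ with $g$ an arrow and $\varphi$ a square, $g$ stands for $\mathrm{U}_g$; a proarrow in a composite of squares stands for its $\mathrm{id}$). Products of double categories are componentwise. A functor is strict: it preserves boundaries and all composition structure in both dimensions. **Natural transformations.** For functors $F,G:\mathbb{E}\to\mathbb{D}$, a (proarrow-dimension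 pseudo) natural transformation $\alpha : F \overset{\bullet}{\to} G$ consists of: for each object $A$ a proarrow $\alpha A : FA \overset{\bullet}{\to} GA$; for each arrow $f : A \to B$ a square $\alpha f$ with left $\alpha A$, right $\alpha B$, top $Ff$, bottom $Gf$; for each proarrow $m : A \overset{\bullet}{\to} B$ an invertible proarrow disk $\alpha m : Fm \odot \alpha B \to \alpha A \odot Gm$; such that (i) $\alpha(\mathrm{id}_A)=\mathrm{id}_{\alpha A}$ and $\alpha(f\cdot g)=\alpha f\cdot\alpha g$; (ii) $\alpha(\mathrm{U}_A)\cong \mathrm{id}_{\alpha A}$ and $\alpha(m\odot n)\cong (Fm\odot\alpha n)\cdot(\alpha m\odot Gn)$; (iii) for each square $\varphi$ with left $m$, right $n$, top $f$, bottom $g$: $(F\varphi\odot\alpha g)\cdot\alpha n=\alpha m\cdot(\alpha f\odot G\varphi)$. (Here this is applied with $\mathbb{E}=\mathbb{C}^\bullet\times\mathbb{C}$, so components are indexed by pairs.) **Difunctors and dinatural transformations.** $\mathbb{C}^{\bullet}$ denotes the proarrow-dimension reflection of $\mathbb{C}$: it has the same objects, arrows, proarrows and squares, but with boundaries in the proarrow dimension transposed (a proarrow $m:A\overset{\bullet}{\to}B$ of $\mathbb{C}$ is a proarrow $B\overset{\bullet}{\to}A$ of $\mathbb{C}^\bullet$, and squares have top and bottom exchanged) and $\odot$-composition order reversed. Thus for $m:A\overset{\bullet}{\to}B$ in $\mathbb{C}$ and $\beta:G\overset{\bullet}{\to}H$, one has $\beta(m,B):G(m,B)\odot\beta(A,B)\to\beta(B,B)\odot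 H(m,B)$ and $\beta(A,m):G(A,m)\odot\beta(A,B)\to\beta(A,A)\odot H(A,m)$. A difunctor is a functor with domain $\mathbb{C}^{\bullet}\times\mathbb{C}$. For difunctors $F,G:\mathbb{C}^{\bullet}\times\mathbb{C}\to\mathbb{D}$, a (proarrow-dimension pseudo) dinatural transformation $\alpha$ from $F$ to $G$ consists of: for each object $A$ of $\mathbb{C}$ a proarrow $\alpha A:F(A,A)\overset{\bullet}{\to}G(A,A)$; for each arrow $f:A\to B$ of $\mathbb{C}$ a square $\alpha f$ with left $\alpha A$, right $\alpha B$, top $F(f,f)$, bottom $G(f,f)$; for each proarrow $m:A\overset{\bullet}{\to}B$ of $\mathbb{C}$ an invertible proarrow disk $\alpha m:F(B,m)\odot\alpha B\odot G(m,B)\to F(m,A)\odot\alpha A\odot G(A,m)$; such that (i) $\alpha(\mathrm{id}_A)=\mathrm{id}_{\alpha A}$, $\alpha(f\cdot g)=\alpha f\cdot\alpha g$; (ii) $\alpha(\mathrm{U}_A)\cong\mathrm{id}_{\alpha A}$ and, for $m:A\overset{\bullet}{\to}B$, $n:B\overset{\bullet}{\to}C$, $\alpha(m\odot n)\cong(F(C,m)\odot\alpha n\odot G(m,C))\cdot(F(n,A)\odot\alpha m\odot G(A,n))$; (iii) for each square $\varphi$ with left $m$, right $n$, top $f$, bottom $g$: $(F(g,\varphi)\odot\alpha g\odot G(\varphi,g))\cdot\alpha n\cong\alpha m\cdot(F(\varphi,f)\odot\alpha f\odot G(f,\varphi))$. *)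

(* Defs.v *)
From Stdlib Require Import Eqdep.
From Corelib Require Import ssreflect ssrfun.

Set Implicit Arguments.
Unset Strict Implicit.
Unset Printing Implicit Defensive.

(* Equality of cells across (provably equal) boundaries: squares are indexed by
   their left, right, top and bottom boundary, and arrow-dimension composition
   is associative and unital only up to propositional equality of arrows. *)
Inductive heq4 (X Y Z W : Type) (S : X -> Y -> Z -> W -> Type)
    (x : X) (y : Y) (z : Z) (w : W) (s : S x y z w) :
    forall (x' : X) (y' : Y) (z' : Z) (w' : W), S x' y' z' w' -> Prop :=
  heq4_refl : @heq4 X Y Z W S x y z w s x y z w s.
Arguments heq4 {X Y Z W} S {x y z w} s {x' y' z' w'} _.

Reserved Notation "f · g" (at level 40, left associativity).
Reserved Notation "φ ·· ψ" (at level 40, left associativity).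
Reserved Notation "m ⊙ n" (at level 39, right associativity).
Reserved Notation "φ ⊙⊙ ψ" (at level 39, right associativity).
Reserved Notation "i ;; j" (at level 42, left associativity).
Reserved Notation "i ⊗ j" (at level 39, right associativity).
Reserved Notation "φ ≡ ψ" (at level 70, no associativity).

(* Weak double categories: strict in the arrow dimension (·), pseudo in the
   proarrow dimension (⊙).  [sq m n f g] has left proarrow [m], right proarrow
   [n], top arrow [f] and bottom arrow [g].  All composites are diagrammatic. *)
Record double_category := DoubleCategory {
  ob :> Type;
  arr : ob -> ob -> Type;
  pro : ob -> ob -> Type;
  sq : forall {A B C D : ob},
    pro A C -> pro B D -> arr A B -> arr C D -> Type;

  aid : forall A, arr A A;
  acomp : forall {A B C}, arr A B -> arr B C -> arr A C
    where "f · g" := (acomp f g);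
  punit : forall A, pro A A;
  pcomp : forall {A B C}, pro A B -> pro B C -> pro A C
    where "m ⊙ n" := (pcomp m n);

  hid : forall {A C} (m : pro A C), sq m m (aid A) (aid C);
  hcomp : forall {A B C A' B' C'} {m : pro A A'} {n : pro B B'} {p : pro C C'}
      {f : arr A B} {f' : arr A' B'} {g : arr B C} {g' : arr B' C'},
    sq m n f f' -> sq n p g g' -> sq m p (f · g) (f' · g')
    where "φ ·· ψ" := (hcomp φ ψ);
  vunit : forall {A B} (f : arr A B), sq (punit A) (punit B) f f;
  vcomp : forall {A B C A' B' C'} {m : pro A B} {n : pro B C}
      {m' : pro A' B'} {n' : pro B' C'}
      {f : arr A A'} {g : arr B B'} {h : arr C C'},
    sq m m' f g -> sq n n' g h -> sq (m ⊙ n) (m' ⊙ n') f h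
    where "φ ⊙⊙ ψ" := (vcomp φ ψ);

  passoc : forall {A B C D} (m : pro A B) (n : pro B C) (p : pro C D),
    sq ((m ⊙ n) ⊙ p) (m ⊙ (n ⊙ p)) (aid A) (aid D);
  passoc_inv : forall {A B C D} (m : pro A B) (n : pro B C) (p : pro C D),
    sq (m ⊙ (n ⊙ p)) ((m ⊙ n) ⊙ p) (aid A) (aid D);
  plunit : forall {A B} (m : pro A B), sq (punit A ⊙ m) m (aid A) (aid B);
  plunit_inv : forall {A B} (m : pro A B), sq m (punit A ⊙ m) (aid A) (aid B);
  prunit : forall {A B} (m : pro A B), sq (m ⊙ punit B) m (aid A) (aid B);
  prunit_inv : forall {A B} (m : pro A B), sq m (m ⊙ punit B) (aid A) (aid B);

  acomp_assoc : forall A B C D (f : arr A B) (g : arr B C) (h : arr C D),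
    f · (g · h) = (f · g) · h;
  acomp_idl : forall A B (f : arr A B), aid A · f = f;
  acomp_idr : forall A B (f : arr A B), f · aid B = f;

  hcomp_assoc : forall A B C D A' B' C' D'
      (m : pro A A') (n : pro B B') (p : pro C C') (q : pro D D')
      (f : arr A B) (f' : arr A' B') (g : arr B C) (g' : arr B' C')
      (h : arr C D) (h' : arr C' D')
      (φ : sq m n f f') (ψ : sq n p g g') (χ : sq p q h h'),
    heq4 (@sq A D A' D') (φ ·· (ψ ·· χ)) ((φ ·· ψ) ·· χ);
  hcomp_idl : forall A B A' B' (m : pro A A') (n : pro B B')
      (f : arr A B) (f' : arr A' B') (φ : sq m n f f'),
    heq4 (@sq A B A' B') (hid m ·· φ) φ;
  hcomp_idr : forall A B A' B' (m : pro A A') (n : pro B B')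
      (f : arr A B) (f' : arr A' B') (φ : sq m n f f'),
    heq4 (@sq A B A' B') (φ ·· hid n) φ;

  vcomp_hcomp : forall A B C A' B' C' A'' B'' C''
      (m : pro A A') (n : pro B B') (p : pro C C')
      (m' : pro A' A'') (n' : pro B' B'') (p' : pro C' C'')
      (f : arr A B) (f' : arr A' B') (f'' : arr A'' B'')
      (g : arr B C) (g' : arr B' C') (g'' : arr B'' C'')
      (φ : sq m n f f') (ψ : sq n p g g')
      (φ' : sq m' n' f' f'') (ψ' : sq n' p' g' g''),
    (φ ·· ψ) ⊙⊙ (φ' ·· ψ') = (φ ⊙⊙ φ') ·· (ψ ⊙⊙ ψ');
  vcomp_hid : forall A B C (m : pro A B) (n : pro B C),
    hid m ⊙⊙ hid n = hid (m ⊙ n);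
  vunit_acomp : forall A B C (f : arr A B) (g : arr B C),
    vunit (f · g) = vunit f ·· vunit g;
  vunit_aid : forall A, vunit (aid A) = hid (punit A);

  passocK : forall A B C D (m : pro A B) (n : pro B C) (p : pro C D),
    heq4 (@sq A A D D) (passoc m n p ·· passoc_inv m n p)
                       (hid ((m ⊙ n) ⊙ p));
  passoc_invK : forall A B C D (m : pro A B) (n : pro B C) (p : pro C D),
    heq4 (@sq A A D D) (passoc_inv m n p ·· passoc m n p)
                       (hid (m ⊙ (n ⊙ p)));
  plunitK : forall A B (m : pro A B),
    heq4 (@sq A A B B) (plunit m ·· plunit_inv m) (hid (punit A ⊙ m));
  plunit_invK : forall A B (m : pro A B),
    heq4 (@sq A A B B) (plunit_inv m ·· plunit m) (hid m);
  prunitK : forall A B (m : pro A B),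
    heq4 (@sq A A B B) (prunit m ·· prunit_inv m) (hid (m ⊙ punit B));
  prunit_invK : forall A B (m : pro A B),
    heq4 (@sq A A B B) (prunit_inv m ·· prunit m) (hid m);

  passoc_nat : forall A B C D A' B' C' D'
      (m : pro A B) (n : pro B C) (p : pro C D)
      (m' : pro A' B') (n' : pro B' C') (p' : pro C' D')
      (f : arr A A') (g : arr B B') (h : arr C C') (k : arr D D')
      (φ : sq m m' f g) (ψ : sq n n' g h) (χ : sq p p' h k),
    heq4 (@sq A A' D D') (((φ ⊙⊙ ψ) ⊙⊙ χ) ·· passoc m' n' p')
                         (passoc m n p ·· (φ ⊙⊙ (ψ ⊙⊙ χ)));
  plunit_nat : forall A B A' B' (m : pro A B) (m' : pro A' B')
      (f : arr A A') (g : arr B B') (φ : sq m m' f g),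
    heq4 (@sq A A' B B') ((vunit f ⊙⊙ φ) ·· plunit m') (plunit m ·· φ);
  prunit_nat : forall A B A' B' (m : pro A B) (m' : pro A' B')
      (f : arr A A') (g : arr B B') (φ : sq m m' f g),
    heq4 (@sq A A' B B') ((φ ⊙⊙ vunit g) ·· prunit m') (prunit m ·· φ);

  passoc_pentagon : forall A B C D E
      (m : pro A B) (n : pro B C) (p : pro C D) (q : pro D E),
    heq4 (@sq A A E E)
      (passoc (m ⊙ n) p q ·· passoc m n (p ⊙ q))
      (((passoc m n p ⊙⊙ hid q) ·· passoc m (n ⊙ p) q)
         ·· (hid m ⊙⊙ passoc n p q));
  passoc_triangle : forall A B C (m : pro A B) (n : pro B C),
    heq4 (@sq A A C C)
      (passoc m (punit B) n ·· (hid m ⊙⊙ plunit n))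
      (prunit m ⊙⊙ hid n)
}.

Arguments arr {d} A B : rename.
Arguments pro {d} A B : rename.
Arguments aid {d} A : rename.
Arguments punit {d} A : rename.

Notation "f · g" := (acomp f g).
Notation "m ⊙ n" := (pcomp m n).
Notation "φ ·· ψ" := (hcomp φ ψ).
Notation "φ ⊙⊙ ψ" := (vcomp φ ψ).
Notation "φ ≡ ψ" := (heq4 (@sq _ _ _ _ _) φ ψ).

Section Heq.
Context {X Y Z W : Type} {S : X -> Y -> Z -> W -> Type}.

Lemma heq4_sym x y z w (s : S x y z w) x' y' z' w' (s' : S x' y' z' w') :
  heq4 S s s' -> heq4 S s' s.
Proof. by case. Qed.

Lemma heq4_trans x y z w (s : S x y z w) x' y' z' w' (s' : S x' y' z' w')
    x'' y'' z'' w'' (s'' : S x'' y'' z'' w'') :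
  heq4 S s s' -> heq4 S s' s'' -> heq4 S s s''.
Proof. by move=> H; case. Qed.

Lemma heq4_pack x y z w (s : S x y z w) x' y' z' w' (s' : S x' y' z' w') :
  heq4 S s s' ->
  existT (fun x => {y & {z & {w & S x y z w}}}) x
    (existT _ y (existT _ z (existT _ w s)))
  = existT _ x' (existT _ y' (existT _ z' (existT _ w' s'))).
Proof. by case. Qed.

Lemma heq4_eq x y z w (s s' : S x y z w) : heq4 S s s' -> s = s'.
Proof.
move=> e; have {e}H := heq4_pack e.
by do 4!have {}H := inj_pair2 _ _ _ _ _ H.
Qed.

End Heq.

Section Disks.
Context {D : double_category}.
Implicit Types A B : D.

Definition castsq {A B A' B' : D} {m : pro A A'} {n : pro B B'}
    {f f1 : arr A B} {g g1 : arr A' B'} (ef : f = f1) (eg : g = g1)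
    (φ : sq m n f g) : sq m n f1 g1 :=
  match ef in _ = f1, eg in _ = g1 return sq m n f1 g1 with
  | eq_refl, eq_refl => φ
  end.

Lemma castsq_heq A B A' B' (m : pro A A') (n : pro B B')
    (f f1 : arr A B) (g g1 : arr A' B') (ef : f = f1) (eg : g = g1)
    (φ : sq m n f g) : castsq ef eg φ ≡ φ.
Proof. by case: f1 / ef; case: g1 / eg. Qed.

Lemma heq_castsq A B A' B' (m : pro A A') (n : pro B B')
    (f f1 : arr A B) (g g1 : arr A' B') (φ : sq m n f g) (φ1 : sq m n f1 g1) :
  φ ≡ φ1 -> exists (ef : f = f1) (eg : g = g1), castsq ef eg φ = φ1.
Proof.
move=> e; have {e}H := heq4_pack e.
do 2!have {}H := inj_pair2 _ _ _ _ _ H; move: H.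
set p := existT _ f _; set q := existT _ f1 _ => epq.
suff: exists (ef : projT1 p = projT1 q)
  (eg : projT1 (projT2 p) = projT1 (projT2 q)),
  castsq ef eg (projT2 (projT2 p)) = projT2 (projT2 q) by [].
by case: q / epq; exists eq_refl, eq_refl.
Qed.

Lemma hcomp_heq A B C A' B' C' (m : pro A A') (n : pro B B') (p : pro C C')
    (f f1 : arr A B) (f' f1' : arr A' B') (g g1 : arr B C) (g' g1' : arr B' C')
    (φ : sq m n f f') (φ1 : sq m n f1 f1')
    (ψ : sq n p g g') (ψ1 : sq n p g1 g1') :
  φ ≡ φ1 -> ψ ≡ ψ1 -> φ ·· ψ ≡ φ1 ·· ψ1.
Proof.
move=> /heq_castsq[ef [ef' e]] /heq_castsq[eg [eg' e']].
by subst; apply: heq4_refl.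
Qed.

Lemma sq_refl A B A' B' (m : pro A A') (n : pro B B')
  (f : arr A B) (g : arr A' B') (φ : sq m n f g) : φ ≡ φ.
Proof. exact: heq4_refl. Qed.

Definition disk {A B : D} (m n : pro A B) : Type := sq m n (aid A) (aid B).

Lemma disk_eq A B (m n : pro A B) (φ ψ : disk m n) : φ ≡ ψ -> φ = ψ.
Proof. exact: heq4_eq. Qed.

Definition dcomp {A B : D} {m n p : pro A B} (φ : disk m n) (ψ : disk n p) :
    disk m p :=
  castsq (acomp_idl (aid A)) (acomp_idl (aid B)) (φ ·· ψ).

Lemma dcomp_heq A B (m n p : pro A B) (φ : disk m n) (ψ : disk n p) :
  dcomp φ ψ ≡ φ ·· ψ.
Proof. exact: castsq_heq. Qed.

Lemma dcompA A B (m n p q : pro A B)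
    (φ : disk m n) (ψ : disk n p) (χ : disk p q) :
  dcomp φ (dcomp ψ χ) = dcomp (dcomp φ ψ) χ.
Proof.
apply: disk_eq; apply: heq4_trans (dcomp_heq _ _) _.
apply: heq4_trans (hcomp_heq (sq_refl _) (dcomp_heq _ _)) _.
apply: heq4_trans (hcomp_assoc _ _ _) _; apply: heq4_sym.
apply: heq4_trans (dcomp_heq _ _) _.
exact: hcomp_heq (dcomp_heq _ _) (sq_refl _).
Qed.

Lemma dcomp_idl A B (m n : pro A B) (φ : disk m n) : dcomp (hid m) φ = φ.
Proof.
by apply: disk_eq; apply: heq4_trans (dcomp_heq _ _) (hcomp_idl _).
Qed.

Lemma dcomp_idr A B (m n : pro A B) (φ : disk m n) : dcomp φ (hid n) = φ.
Proof.
by apply: disk_eq; apply: heq4_trans (dcomp_heq _ _) (hcomp_idr _).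
Qed.

Lemma castsq_vcomp A B C A' B' C' (m : pro A B) (n : pro B C)
    (m' : pro A' B') (n' : pro B' C') (f f1 : arr A A') (g g1 : arr B B')
    (h h1 : arr C C') (ef : f = f1) (eg : g = g1) (eh : h = h1)
    (φ : sq m m' f g) (ψ : sq n n' g h) :
  castsq ef eh (φ ⊙⊙ ψ) = castsq ef eg φ ⊙⊙ castsq eg eh ψ.
Proof. by case: f1 / ef; case: g1 / eg; case: h1 / eh. Qed.

Lemma dcomp_vcomp A B C (m n p : pro A B) (m' n' p' : pro B C)
    (φ : disk m n) (ψ : disk n p) (φ' : disk m' n') (ψ' : disk n' p') :
  dcomp (φ ⊙⊙ φ') (ψ ⊙⊙ ψ') = dcomp φ ψ ⊙⊙ dcomp φ' ψ'.
Proof.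
by rewrite /dcomp -vcomp_hcomp (castsq_vcomp _ (acomp_idl (aid B))).
Qed.

(* Invertible proarrow disks, with their (unique) inverse. *)
Record diso {A B : D} (m n : pro A B) := Diso {
  fwd : disk m n;
  bwd : disk n m;
  fwdK : dcomp fwd bwd = hid m;
  bwdK : dcomp bwd fwd = hid n
}.

Definition diso_id {A B : D} (m : pro A B) : diso m m :=
  @Diso A B m m (hid m) (hid m) (dcomp_idl _) (dcomp_idl _).

Definition diso_inv {A B : D} {m n : pro A B} (i : diso m n) : diso n m :=
  Diso (bwdK i) (fwdK i).

Lemma diso_comp_subproof A B (m n p : pro A B) (i : diso m n) (j : diso n p) :
  dcomp (dcomp (fwd i) (fwd j)) (dcomp (bwd j) (bwd i)) = hid m.
Proof. by rewrite dcompA -(dcompA (fwd i)) fwdK dcomp_idr fwdK. Qed.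

Definition diso_comp {A B : D} {m n p : pro A B}
    (i : diso m n) (j : diso n p) : diso m p :=
  Diso (diso_comp_subproof i j)
       (diso_comp_subproof (diso_inv j) (diso_inv i)).

Lemma diso_vcomp_subproof A B C (m n : pro A B) (m' n' : pro B C)
    (i : diso m n) (j : diso m' n') :
  dcomp (fwd i ⊙⊙ fwd j) (bwd i ⊙⊙ bwd j) = hid (m ⊙ m').
Proof. by rewrite dcomp_vcomp !fwdK vcomp_hid. Qed.

Definition diso_vcomp {A B C : D} {m n : pro A B} {m' n' : pro B C}
    (i : diso m n) (j : diso m' n') : diso (m ⊙ m') (n ⊙ n') :=
  @Diso A C (m ⊙ m') (n ⊙ n') (fwd i ⊙⊙ fwd j) (bwd i ⊙⊙ bwd j)
    (diso_vcomp_subproof i j)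
    (diso_vcomp_subproof (diso_inv i) (diso_inv j)).

Definition diso_of_eq {A B : D} {m n : pro A B} (e : m = n) : diso m n :=
  match e with eq_refl => diso_id m end.

Lemma disk_inverse A B (m n : pro A B) (φ : disk m n) (ψ : disk n m) :
  φ ·· ψ ≡ hid m -> dcomp φ ψ = hid m.
Proof. by move=> H; apply: disk_eq; apply: heq4_trans (dcomp_heq _ _) H. Qed.

Definition assoc {A B C E : D} (m : pro A B) (n : pro B C) (p : pro C E) :
    diso ((m ⊙ n) ⊙ p) (m ⊙ (n ⊙ p)) :=
  Diso (disk_inverse (passocK m n p)) (disk_inverse (passoc_invK m n p)).

Definition lunit {A B : D} (m : pro A B) : diso (punit A ⊙ m) m :=
  Diso (disk_inverse (plunitK m)) (disk_inverse (plunit_invK m)).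

Definition runit {A B : D} (m : pro A B) : diso (m ⊙ punit B) m :=
  Diso (disk_inverse (prunitK m)) (disk_inverse (prunit_invK m)).

End Disks.

Notation "i ;; j" := (diso_comp i j).
Notation "i ⊗ j" := (diso_vcomp i j).

(* The proarrow-dimension reflection C^•. *)
Section Reflection.
Variable C : double_category.

Definition reflection_sq (A B A' B' : C) (m : pro A' A) (n : pro B' B)
  (f : arr A B) (g : arr A' B') : Type := sq m n g f.

Lemma heq_refl_sq (A B A' B' : C) (m m1 : pro A' A) (n n1 : pro B' B)
    (f f1 : arr A B) (g g1 : arr A' B')
    (φ : sq m n g f) (φ1 : sq m1 n1 g1 f1) :
  φ ≡ φ1 ->
  heq4 (@reflection_sq A B A' B')
    (φ : reflection_sq m n f g) (φ1 : reflection_sq m1 n1 f1 g1).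
Proof. by case. Qed.

Lemma passoc_inv_nat (A B E F A' B' E' F' : C)
    (m : pro A B) (n : pro B E) (p : pro E F)
    (m' : pro A' B') (n' : pro B' E') (p' : pro E' F')
    (f : arr A A') (g : arr B B') (h : arr E E') (k : arr F F')
    (φ : sq m m' f g) (ψ : sq n n' g h) (χ : sq p p' h k) :
  (φ ⊙⊙ (ψ ⊙⊙ χ)) ·· passoc_inv m' n' p'
  ≡ passoc_inv m n p ·· ((φ ⊙⊙ ψ) ⊙⊙ χ).
Proof.
apply: heq4_sym; apply: heq4_trans (heq4_sym (hcomp_idr _)) _.
apply: heq4_trans (hcomp_heq (sq_refl _) (heq4_sym (passocK _ _ _))) _.
apply: heq4_trans (hcomp_assoc _ _ _) _.
apply: hcomp_heq (sq_refl _).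
apply: heq4_trans (heq4_sym (hcomp_assoc _ _ _)) _.
apply: heq4_trans (hcomp_heq (sq_refl _) (passoc_nat _ _ _)) _.
apply: heq4_trans (hcomp_assoc _ _ _) _.
apply: heq4_trans (hcomp_heq (passoc_invK _ _ _) (sq_refl _)) _.
exact: hcomp_idl.
Qed.

Lemma diso_inv_uniq (A B : C) (m n : pro A B) (i j : diso m n) :
  fwd i = fwd j -> bwd i = bwd j.
Proof.
move=> e; rewrite -[bwd i]dcomp_idr -(fwdK j) dcompA -e.
by rewrite (bwdK i) dcomp_idl.
Qed.

Lemma passoc_inv_pentagon (A B E F G : C)
    (m : pro A B) (n : pro B E) (p : pro E F) (q : pro F G) :
  passoc_inv m n (p ⊙ q) ·· passoc_inv (m ⊙ n) p q
  ≡ ((hid m ⊙⊙ passoc_inv n p q) ·· passoc_inv m (n ⊙ p) q)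
       ·· (passoc_inv m n p ⊙⊙ hid q).
Proof.
pose i := assoc (m ⊙ n) p q ;; assoc m n (p ⊙ q).
pose j := ((assoc m n p ⊗ diso_id q) ;; assoc m (n ⊙ p) q)
            ;; (diso_id m ⊗ assoc n p q).
have /diso_inv_uniq /= e : fwd i = fwd j.
  apply: disk_eq; apply: heq4_trans (dcomp_heq _ _) _.
  apply: heq4_trans (passoc_pentagon _ _ _ _) _.
  apply: heq4_sym; apply: heq4_trans (dcomp_heq _ _) _.
  exact: hcomp_heq (dcomp_heq _ _) (sq_refl _).
apply: heq4_trans (heq4_sym (dcomp_heq _ _)) _; rewrite e.
apply: heq4_trans (dcomp_heq _ _) _.
apply: heq4_trans (hcomp_heq (sq_refl _) (dcomp_heq _ _)) _.
exact: hcomp_assoc.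
Qed.

Lemma passoc_inv_triangle (A B E : C) (m : pro A B) (n : pro B E) :
  passoc_inv m (punit B) n ·· (prunit m ⊙⊙ hid n) ≡ hid m ⊙⊙ plunit n.
Proof.
apply: heq4_trans
  (hcomp_heq (sq_refl _) (heq4_sym (passoc_triangle m n))) _.
apply: heq4_trans (hcomp_assoc _ _ _) _.
apply: heq4_trans (hcomp_heq (passoc_invK _ _ _) (sq_refl _)) _.
exact: hcomp_idl.
Qed.

Definition reflection : double_category.
Proof.
refine (@DoubleCategory C (fun A B => arr A B) (fun A B => pro B A)
  (fun A B A' B' m n f g => sq m n g f)
  (fun A => aid A) (fun A B E f g => f · g)
  (fun A => punit A) (fun A B E m n => n ⊙ m)
  (fun A B m => hid m)
  (fun A B E A' B' E' m n p f f' g g' φ ψ => φ ·· ψ)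
  (fun A B f => vunit f)
  (fun A B E A' B' E' m n m' n' f g h φ ψ => ψ ⊙⊙ φ)
  (fun A B E F m n p => passoc_inv p n m)
  (fun A B E F m n p => passoc p n m)
  (fun A B m => prunit m) (fun A B m => prunit_inv m)
  (fun A B m => plunit m) (fun A B m => plunit_inv m)
  _ _ _ _ _ _ _ _ _ _ _ _ _ _ _ _ _ _ _ _ _);
  intros; first
  [ exact: acomp_assoc | exact: acomp_idl | exact: acomp_idr
  | exact: vcomp_hcomp | exact: vcomp_hid | exact: vunit_acomp
  | exact: vunit_aid
  | apply: heq_refl_sq; first
    [ exact: hcomp_assoc | exact: hcomp_idl | exact: hcomp_idr
    | exact: passocK | exact: passoc_invK | exact: plunitK
    | exact: plunit_invK | exact: prunitK | exact: prunit_invK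
    | exact: passoc_inv_nat | exact: plunit_nat | exact: prunit_nat
    | exact: passoc_inv_pentagon | exact: passoc_inv_triangle ] ].
Defined.

End Reflection.

Section Product.
Variables C D : double_category.

Definition prod_sq (A B A' B' : C * D)
    (m : pro A.1 A'.1 * pro A.2 A'.2) (n : pro B.1 B'.1 * pro B.2 B'.2)
    (f : arr A.1 B.1 * arr A.2 B.2) (g : arr A'.1 B'.1 * arr A'.2 B'.2) : Type :=
  sq m.1 n.1 f.1 g.1 * sq m.2 n.2 f.2 g.2.

Lemma heq_prod_sq (A B A' B' : C * D)
    (m m1 : pro A.1 A'.1 * pro A.2 A'.2) (n n1 : pro B.1 B'.1 * pro B.2 B'.2)
    (f f1 : arr A.1 B.1 * arr A.2 B.2) (g g1 : arr A'.1 B'.1 * arr A'.2 B'.2)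
    (φ : prod_sq m n f g) (φ1 : prod_sq m1 n1 f1 g1) :
  φ.1 ≡ φ1.1 -> φ.2 ≡ φ1.2 -> heq4 (@prod_sq A B A' B') φ φ1.
Proof.
case: m n f g φ => [m m'] [n n'] [f f'] [g g'] [/= φ φ'].
case: m1 n1 f1 g1 φ1 => [m1 m1'] [n1 n1'] [f1 f1'] [g1 g1'] [/= φ1 φ1'].
by move=> /= H H'; case: H; case: H'.
Qed.

Definition product : double_category.
Proof.
refine (@DoubleCategory (C * D)%type
  (fun A B => (arr A.1 B.1 * arr A.2 B.2)%type)
  (fun A B => (pro A.1 B.1 * pro A.2 B.2)%type)
  (fun A B A' B' m n f g => @prod_sq A B A' B' m n f g)
  (fun A => (aid A.1, aid A.2))
  (fun A B E f g => (f.1 · g.1, f.2 · g.2))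
  (fun A => (punit A.1, punit A.2))
  (fun A B E m n => (m.1 ⊙ n.1, m.2 ⊙ n.2))
  (fun A B m => (hid m.1, hid m.2))
  (fun A B E A' B' E' m n p f f' g g' φ ψ => (φ.1 ·· ψ.1, φ.2 ·· ψ.2))
  (fun A B f => (vunit f.1, vunit f.2))
  (fun A B E A' B' E' m n m' n' f g h φ ψ => (φ.1 ⊙⊙ ψ.1, φ.2 ⊙⊙ ψ.2))
  (fun A B E F m n p => (passoc m.1 n.1 p.1, passoc m.2 n.2 p.2))
  (fun A B E F m n p => (passoc_inv m.1 n.1 p.1, passoc_inv m.2 n.2 p.2))
  (fun A B m => (plunit m.1, plunit m.2))
  (fun A B m => (plunit_inv m.1, plunit_inv m.2))
  (fun A B m => (prunit m.1, prunit m.2))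
  (fun A B m => (prunit_inv m.1, prunit_inv m.2))
  _ _ _ _ _ _ _ _ _ _ _ _ _ _ _ _ _ _ _ _ _);
  intros;
  first
  [ apply: heq_prod_sq; cbn; first
    [ exact: hcomp_assoc | exact: hcomp_idl | exact: hcomp_idr
    | exact: passocK | exact: passoc_invK | exact: plunitK
    | exact: plunit_invK | exact: prunitK | exact: prunit_invK
    | exact: passoc_nat | exact: plunit_nat | exact: prunit_nat
    | exact: passoc_pentagon | exact: passoc_triangle ]
  | cbn; rewrite ?acomp_assoc ?acomp_idl ?acomp_idr ?vcomp_hcomp ?vcomp_hid
      ?vunit_acomp ?vunit_aid; first [ reflexivity | by case: f ] ].
Defined.

End Product.

Section ProductDiso.
Context {C D : double_category}.

Lemma pair_diso_subproof (A B : C) (A' B' : D) (m n : pro A B)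
    (m' n' : pro A' B') (i : diso m n) (i' : diso m' n') :
  dcomp (D := product C D) (A := (A, A')) (B := (B, B'))
    (m := (m, m')) (n := (n, n')) (p := (m, m'))
    (fwd i, fwd i') (bwd i, bwd i') = (hid m, hid m').
Proof.
apply: disk_eq; apply: heq4_trans (dcomp_heq _ _) _.
apply: heq_prod_sq => /=; apply: heq4_trans (heq4_sym (dcomp_heq _ _)) _.
  by rewrite (fwdK i); apply: sq_refl.
by rewrite (fwdK i'); apply: sq_refl.
Qed.

Definition pair_diso {A B : C} {A' B' : D} {m n : pro A B} {m' n' : pro A' B'}
    (i : diso m n) (i' : diso m' n') :
    @diso (product C D) (A, A') (B, B') (m, m') (n, n') :=
  @Diso (product C D) (A, A') (B, B') (m, m') (n, n')
    (fwd i, fwd i') (bwd i, bwd i')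
    (pair_diso_subproof i i')
    (pair_diso_subproof (diso_inv i) (diso_inv i')).

End ProductDiso.

Record functor (E D : double_category) := Functor {
  fob :> E -> D;
  farr : forall {A B : E}, arr A B -> arr (fob A) (fob B);
  fpro : forall {A B : E}, pro A B -> pro (fob A) (fob B);
  fsq : forall {A B A' B' : E} {m : pro A A'} {n : pro B B'}
      {f : arr A B} {g : arr A' B'},
    sq m n f g -> sq (fpro m) (fpro n) (farr f) (farr g);

  farr_aid : forall A, farr (aid A) = aid (fob A);
  farr_acomp : forall A B C (f : arr A B) (g : arr B C),
    farr (f · g) = farr f · farr g;
  fpro_punit : forall A, fpro (punit A) = punit (fob A);
  fpro_pcomp : forall A B C (m : pro A B) (n : pro B C),
    fpro (m ⊙ n) = fpro m ⊙ fpro n;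

  fsq_hid : forall A B (m : pro A B), fsq (hid m) ≡ hid (fpro m);
  fsq_hcomp : forall A B C A' B' C'
      (m : pro A A') (n : pro B B') (p : pro C C')
      (f : arr A B) (f' : arr A' B') (g : arr B C) (g' : arr B' C')
      (φ : sq m n f f') (ψ : sq n p g g'),
    fsq (φ ·· ψ) ≡ fsq φ ·· fsq ψ;
  fsq_vunit : forall A B (f : arr A B), fsq (vunit f) ≡ vunit (farr f);
  fsq_vcomp : forall A B C A' B' C' (m : pro A B) (n : pro B C)
      (m' : pro A' B') (n' : pro B' C')
      (f : arr A A') (g : arr B B') (h : arr C C')
      (φ : sq m m' f g) (ψ : sq n n' g h),
    fsq (φ ⊙⊙ ψ) ≡ fsq φ ⊙⊙ fsq ψ;
  fsq_passoc : forall A B C F (m : pro A B) (n : pro B C) (p : pro C F),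
    fsq (passoc m n p) ≡ passoc (fpro m) (fpro n) (fpro p);
  fsq_plunit : forall A B (m : pro A B), fsq (plunit m) ≡ plunit (fpro m);
  fsq_prunit : forall A B (m : pro A B), fsq (prunit m) ≡ prunit (fpro m)
}.

Section FunctorDiso.
Variables (E D : double_category) (F : functor E D).
Implicit Types A B : E.

Definition fdisk {A B : E} {m n : pro A B} (φ : disk m n) :
    disk (fpro F m) (fpro F n) :=
  castsq (farr_aid F A) (farr_aid F B) (fsq F φ).

Lemma fdisk_heq A B (m n : pro A B) (φ : disk m n) : fdisk φ ≡ fsq F φ.
Proof. exact: castsq_heq. Qed.

Lemma fsq_heq A B A' B' (m : pro A A') (n : pro B B')
    (f f1 : arr A B) (g g1 : arr A' B') (φ : sq m n f g) (φ1 : sq m n f1 g1) :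
  φ ≡ φ1 -> fsq F φ ≡ fsq F φ1.
Proof. by move=> /heq_castsq[ef [eg e]]; subst; apply: sq_refl. Qed.

Lemma fdiso_subproof A B (m n : pro A B) (i : diso m n) :
  dcomp (fdisk (fwd i)) (fdisk (bwd i)) = hid (fpro F m).
Proof.
apply: disk_eq; apply: heq4_trans (dcomp_heq _ _) _.
apply: heq4_trans (hcomp_heq (fdisk_heq _) (fdisk_heq _)) _.
apply: heq4_trans (heq4_sym (fsq_hcomp _ _ _)) _.
apply: heq4_trans (fsq_heq (heq4_sym (dcomp_heq _ _))) _.
by rewrite (fwdK i); apply: fsq_hid.
Qed.

Definition fdiso {A B : E} {m n : pro A B} (i : diso m n) :
    diso (fpro F m) (fpro F n) :=
  Diso (fdiso_subproof i) (fdiso_subproof (diso_inv i)).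

End FunctorDiso.

(* The equations holding only up to coherators (fields [npro_punit] and [npro_pcomp]) have the
   coherators inserted. *)
Record nattrans {E D : double_category} (F G : functor E D) := NatTrans {
  nob :> forall A : E, pro (F A) (G A);
  narr : forall {A B : E} (f : arr A B),
    sq (nob A) (nob B) (farr F f) (farr G f);
  npro : forall {A B : E} (m : pro A B),
    diso (fpro F m ⊙ nob B) (nob A ⊙ fpro G m);

  narr_aid : forall A, narr (aid A) ≡ hid (nob A);
  narr_acomp : forall A B C (f : arr A B) (g : arr B C),
    narr (f · g) ≡ narr f ·· narr g;
  npro_punit : forall A,
    fwd (npro (punit A))
    ≡ fwd (lunit (nob A) ;; diso_id (nob A) ;; diso_inv (runit (nob A)));
  npro_pcomp : forall A B C (m : pro A B) (n : pro B C),
    fwd (npro (m ⊙ n))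
    ≡ fwd (assoc (fpro F m) (fpro F n) (nob C)
           ;; (diso_id (fpro F m) ⊗ npro n)
           ;; diso_inv (assoc (fpro F m) (nob B) (fpro G n))
           ;; (npro m ⊗ diso_id (fpro G n))
           ;; assoc (nob A) (fpro G m) (fpro G n));
  npro_nat : forall A B A' B' (m : pro A A') (n : pro B B')
      (f : arr A B) (g : arr A' B') (φ : sq m n f g),
    (fsq F φ ⊙⊙ narr g) ·· fwd (npro n)
    ≡ fwd (npro m) ·· (narr f ⊙⊙ fsq G φ)
}.

Definition difunctor (C D : double_category) : Type :=
  functor (product (reflection C) C) D.

(* Cells (m, n) of C^• × C, with the first component given as a cell of C. *)
Section Pairs.
Context {C : double_category}.

Definition biarr {A B A' B' : C} (f : arr A B) (g : arr A' B') :
    @arr (product (reflection C) C) (A, A') (B, B') := (f, g).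

Definition bipro {A B A' B' : C} (m : pro A B) (n : pro A' B') :
    @pro (product (reflection C) C) (B, A') (A, B') := (m, n).

Definition bisq {A B P Q A' B' P' Q' : C}
    {m : pro A P} {n : pro B Q} {f : arr A B} {g : arr P Q}
    {m' : pro A' P'} {n' : pro B' Q'} {f' : arr A' B'} {g' : arr P' Q'}
    (φ : sq m n f g) (ψ : sq m' n' f' g') :
    sq (bipro m m') (bipro n n') (biarr g f') (biarr f g') :=
  (φ, ψ).

End Pairs.

Definition transpose {C : double_category} {A B : C} (m : pro A B) :
  @pro (reflection C) B A := m.

Section DifunctorCoherators.
Context {C D : double_category} (F : difunctor C D).

(* F(X, m ⊙ n) → F(X, m) ⊙ F(X, n) *)
Definition split_cov (X : C) {A B E : C} (m : pro A B) (n : pro B E) :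
    diso (fpro F (bipro (punit X) (m ⊙ n)))
         (fpro F (bipro (punit X) m) ⊙ fpro F (bipro (punit X) n)) :=
  fdiso F (pair_diso (diso_inv (lunit (transpose (punit X)))) (diso_id (m ⊙ n)))
  ;; diso_of_eq (fpro_pcomp F (bipro (punit X) m) (bipro (punit X) n)).

(* F(m ⊙ n, X) → F(n, X) ⊙ F(m, X) *)
Definition split_contra {A B E : C} (m : pro A B) (n : pro B E) (X : C) :
    diso (fpro F (bipro (m ⊙ n) (punit X)))
         (fpro F (bipro n (punit X)) ⊙ fpro F (bipro m (punit X))) :=
  fdiso F (pair_diso (diso_id (transpose n ⊙ transpose m)) (diso_inv (lunit (punit X))))
  ;; diso_of_eq (fpro_pcomp F (bipro n (punit X)) (bipro m (punit X))).

(* F(Y, n) ⊙ F(m, B) → F(m, A) ⊙ F(X, n) *)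
Definition interchange {X Y A B : C} (m : pro X Y) (n : pro A B) :
    diso (fpro F (bipro (punit Y) n) ⊙ fpro F (bipro m (punit B)))
         (fpro F (bipro m (punit A)) ⊙ fpro F (bipro (punit X) n)) :=
  diso_inv
    (diso_of_eq (fpro_pcomp F (bipro (punit Y) n) (bipro m (punit B))))
  ;; fdiso F (pair_diso (lunit (transpose m) ;; diso_inv (runit (transpose m)))
                        (runit n ;; diso_inv (lunit n)))
  ;; diso_of_eq (fpro_pcomp F (bipro m (punit A)) (bipro (punit X) n)).

End DifunctorCoherators.

(* (p ⊙ q) ⊙ (a ⊙ (r ⊙ s)) → p ⊙ ((q ⊙ (a ⊙ r)) ⊙ s) *)
Definition nest {D : double_category} {A1 A2 A3 A4 A5 A6 : D}
    (p : pro A1 A2) (q : pro A2 A3) (a : pro A3 A4)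
    (r : pro A4 A5) (s : pro A5 A6) :
    diso ((p ⊙ q) ⊙ (a ⊙ (r ⊙ s))) (p ⊙ ((q ⊙ (a ⊙ r)) ⊙ s)) :=
  assoc p q (a ⊙ (r ⊙ s))
  ;; (diso_id p ⊗ (diso_id q ⊗ diso_inv (assoc a r s)))
  ;; (diso_id p ⊗ diso_inv (assoc q (a ⊙ r) s)).

(* Triple composites x ⊙ y ⊙ z are bracketed to the right. *)
Record dinat_data {C D : double_category} (F G : difunctor C D) := DinatData {
  dob : forall A : C, pro (F (A, A)) (G (A, A));
  darr : forall (A B : C) (f : arr A B),
    sq (dob A) (dob B) (farr F (biarr f f)) (farr G (biarr f f));
  dpro : forall (A B : C) (m : pro A B),
    diso
      (fpro F (bipro (punit B) m) ⊙ dob B ⊙ fpro G (bipro m (punit B)))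
      (fpro F (bipro m (punit A)) ⊙ dob A ⊙ fpro G (bipro (punit A) m))
}.
Arguments dob {C D F G} d A : rename.
Arguments darr {C D F G} d {A B} f : rename.
Arguments dpro {C D F G} d {A B} m : rename.

Record dinat {C D : double_category} (F G : difunctor C D) := Dinat {
  dinat_cells :> dinat_data F G;

  darr_aid : forall A : C, darr dinat_cells (aid A) ≡ hid (dob dinat_cells A);
  darr_acomp : forall (A B E : C) (f : arr A B) (g : arr B E),
    darr dinat_cells (f · g) ≡ darr dinat_cells f ·· darr dinat_cells g;

  (* [F (A, U_A) = F (U_A, A) = U_(F (A, A))] by strictness, so the coherator
     at both ends is U ⊙ αA ⊙ U → αA. *)
  dpro_punit : forall A : C,
    let c := lunit (dob dinat_cells A ⊙ punit (G (A, A)))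
             ;; runit (dob dinat_cells A) in
    fwd (dpro dinat_cells (punit A))
    ≡ fwd (c ;; diso_id (dob dinat_cells A) ;; diso_inv c);

  dpro_pcomp : forall (A B E : C) (m : pro A B) (n : pro B E),
    fwd (dpro dinat_cells (m ⊙ n))
    ≡ fwd ((split_cov F E m n
              ⊗ (diso_id (dob dinat_cells E) ⊗ split_contra G m n E))
           ;; nest _ _ _ _ _
           ;; (diso_id (fpro F (bipro (punit E) m))
                 ⊗ (dpro dinat_cells n
                      ⊗ diso_id (fpro G (bipro m (punit E)))))
           ;; diso_inv (nest _ _ _ _ _)
           ;; (interchange F n m
                 ⊗ (diso_id (dob dinat_cells B) ⊗ interchange G m n))
           ;; nest _ _ _ _ _
           ;; (diso_id (fpro F (bipro n (punit A)))
                 ⊗ (dpro dinat_cells m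
                      ⊗ diso_id (fpro G (bipro (punit A) n))))
           ;; diso_inv (nest _ _ _ _ _)
           ;; (diso_inv (split_contra F m n A)
                 ⊗ (diso_id (dob dinat_cells A)
                      ⊗ diso_inv (split_cov G A m n))));

  dpro_nat : forall (A B P Q : C) (m : pro A P) (n : pro B Q)
      (f : arr A B) (g : arr P Q) (φ : sq m n f g),
    (fsq F (bisq (vunit g) φ)
       ⊙⊙ darr dinat_cells g ⊙⊙ fsq G (bisq φ (vunit g)))
      ·· fwd (dpro dinat_cells n)
    ≡ fwd (dpro dinat_cells m)
      ·· (fsq F (bisq φ (vunit f))
            ⊙⊙ darr dinat_cells f ⊙⊙ fsq G (bisq (vunit f) φ))
}.

(* Main.v *)
(** The disk of the composite at a proarrow [m] is natural because each of its
    factors is, and at a unit it is trivial since [α(U)] is and the factors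
    [β(U,U)^-1] and [β(U,U)] cancel.  For [m ⊙ n], naturality of [β] against
    the disks comparing [(m ⊙ n, U)] with [(n, U) ⊙ (m, U)], and the like,
    reduces the claim to three facts: [β(m ⊙ n, E)] and [β(A, m ⊙ n)] split
    into [β]'s at [m] and [n], and [β(m, -)] and [β(-, n)] slide past the
    interchanges of [G] and [H].  The pasting is then an exercise in sliding
    disks past one another, carried out after removing the associators by a
    Cayley-style strictification: a formal composite [e] acts on proarrows by
    [t ↦ e1 ⊙ (e2 ⊙ ... ⊙ t)], so that reassociating [e] changes nothing, and
    a disk is determined by its action on [t = U]. *)

From Corelib Require Import ssreflect ssrfun.
Require Import Defs.

Set Implicit Arguments.
Unset Strict Implicit.
Unset Printing Implicit Defensive.

Notation "φ » ψ" := (dcomp φ ψ) (at level 41, right associativity).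

(** * Calculus of disks: cancellation, interchange, and the coherence of associators *)

Section Disks.
Context {D : double_category}.
Implicit Types A B : D.

(** Composites are kept bracketed to the right, so an equation between two adjacent factors has to
    be usable in front of an arbitrary tail [χ]. *)
Lemma dcomp_eqr A B (m n n' p q : pro A B) (φ : disk m n) (ψ : disk n p)
    (φ' : disk m n') (ψ' : disk n' p) :
  φ » ψ = φ' » ψ' -> forall χ : disk p q, φ » ψ » χ = φ' » ψ' » χ.
Proof. by move=> e χ; rewrite !dcompA e. Qed.

Lemma fwd_comp A B (m n p : pro A B) (i : diso m n) (j : diso n p) :
  fwd (i ;; j) = fwd i » fwd j.
Proof. by []. Qed.

Lemma bwd_comp A B (m n p : pro A B) (i : diso m n) (j : diso n p) :
  bwd (i ;; j) = bwd j » bwd i.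
Proof. by []. Qed.

Lemma fwd_vcomp A B C (m n : pro A B) (m' n' : pro B C)
    (i : diso m n) (j : diso m' n') :
  fwd (i ⊗ j) = fwd i ⊙⊙ fwd j.
Proof. by []. Qed.

Lemma bwd_vcomp A B C (m n : pro A B) (m' n' : pro B C)
    (i : diso m n) (j : diso m' n') :
  bwd (i ⊗ j) = bwd i ⊙⊙ bwd j.
Proof. by []. Qed.

Lemma fwd_inv A B (m n : pro A B) (i : diso m n) : fwd (diso_inv i) = bwd i.
Proof. by []. Qed.

Lemma bwd_inv A B (m n : pro A B) (i : diso m n) : bwd (diso_inv i) = fwd i.
Proof. by []. Qed.

Lemma fwd_id A B (m : pro A B) : fwd (diso_id m) = hid m.
Proof. by []. Qed.

Lemma bwd_id A B (m : pro A B) : bwd (diso_id m) = hid m.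
Proof. by []. Qed.

Definition disoE :=
  (fwd_comp, bwd_comp, fwd_vcomp, bwd_vcomp, fwd_inv, bwd_inv, fwd_id, bwd_id).

Lemma dcomp_cancel A B (m n : pro A B) (φ : disk m n) (ψ : disk n m) :
  φ » ψ = hid m -> forall (p : pro A B) (χ : disk m p), φ » ψ » χ = χ.
Proof. by move=> e p χ; rewrite dcompA e dcomp_idl. Qed.

Lemma fwdKr A B (m n p : pro A B) (i : diso m n) (φ : disk m p) :
  fwd i » bwd i » φ = φ.
Proof. by rewrite dcompA fwdK dcomp_idl. Qed.

Lemma bwdKr A B (m n p : pro A B) (i : diso m n) (φ : disk n p) :
  bwd i » fwd i » φ = φ.
Proof. by rewrite dcompA bwdK dcomp_idl. Qed.

Lemma vcomp_dcompl A B C (m : pro A B) (n p q : pro B C)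
    (φ : disk n p) (ψ : disk p q) :
  hid m ⊙⊙ (φ » ψ) = (hid m ⊙⊙ φ) » (hid m ⊙⊙ ψ).
Proof. by rewrite dcomp_vcomp dcomp_idl. Qed.

Lemma vcomp_dcompr A B C (m : pro B C) (n p q : pro A B)
    (φ : disk n p) (ψ : disk p q) :
  (φ » ψ) ⊙⊙ hid m = (φ ⊙⊙ hid m) » (ψ ⊙⊙ hid m).
Proof. by rewrite dcomp_vcomp dcomp_idl. Qed.

Lemma vcomp_eql A B C (m : pro A B) (n p p' q : pro B C)
    (φ : disk n p) (ψ : disk p q) (φ' : disk n p') (ψ' : disk p' q) :
  φ » ψ = φ' » ψ' ->
  (hid m ⊙⊙ φ) » (hid m ⊙⊙ ψ) = (hid m ⊙⊙ φ') » (hid m ⊙⊙ ψ').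
Proof. by rewrite -!vcomp_dcompl => ->. Qed.

Lemma vcomp_idl A B C (m : pro A B) (n p : pro B C)
    (φ : disk n p) (ψ : disk p n) :
  φ » ψ = hid n -> (hid m ⊙⊙ φ) » (hid m ⊙⊙ ψ) = hid (m ⊙ n).
Proof. by rewrite -vcomp_dcompl => ->; rewrite vcomp_hid. Qed.

Lemma vcomp_swap A B C (m m' : pro A B) (n n' : pro B C)
    (φ : disk m m') (ψ : disk n n') :
  (φ ⊙⊙ hid n) » (hid m' ⊙⊙ ψ) = (hid m ⊙⊙ ψ) » (φ ⊙⊙ hid n').
Proof. by rewrite !dcomp_vcomp !dcomp_idl !dcomp_idr. Qed.

Lemma assoc_nat A B C E (m m' : pro A B) (n n' : pro B C) (p p' : pro C E)
    (φ : disk m m') (ψ : disk n n') (χ : disk p p') :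
  ((φ ⊙⊙ ψ) ⊙⊙ χ) » fwd (assoc m' n' p')
  = fwd (assoc m n p) » (φ ⊙⊙ (ψ ⊙⊙ χ)).
Proof.
apply: disk_eq; apply: heq4_trans (dcomp_heq _ _) _.
by apply: heq4_trans (passoc_nat _ _ _) _; apply: heq4_sym; apply: dcomp_heq.
Qed.

Lemma pentagon A B C E F (m : pro A B) (n : pro B C) (p : pro C E)
    (q : pro E F) :
  (fwd (assoc m n p) ⊙⊙ hid q) » fwd (assoc m (n ⊙ p) q)
    » (hid m ⊙⊙ fwd (assoc n p q))
  = fwd (assoc (m ⊙ n) p q) » fwd (assoc m n (p ⊙ q)).
Proof.
rewrite dcompA; apply: disk_eq; apply: heq4_trans (dcomp_heq _ _) _.
apply: heq4_trans (hcomp_heq (dcomp_heq _ _) (sq_refl _)) _.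
apply: heq4_trans (heq4_sym (passoc_pentagon _ _ _ _)) _.
by apply: heq4_sym; apply: dcomp_heq.
Qed.

(** By naturality of the right unitor, a disk is the conjugate of its whiskering by the unit
    proarrow. *)
Lemma vcomp_punit_inj A B (m n : pro A B) (φ ψ : disk m n) :
  φ ⊙⊙ hid (punit B) = ψ ⊙⊙ hid (punit B) -> φ = ψ.
Proof.
have E (χ : disk m n) :
    χ = bwd (runit m) » (χ ⊙⊙ hid (punit B)) » fwd (runit n).
  rewrite -[LHS](bwdKr (runit m)); congr (_ » _).
  apply: disk_eq; apply: heq4_trans (dcomp_heq _ _) _; apply: heq4_sym.
  apply: heq4_trans (dcomp_heq _ _) _.
  (* Naturality of the unitor is stated for [vunit], and [hid] of a unit proarrow is [vunit] of an
     identity arrow. *)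
  by rewrite -vunit_aid; apply: prunit_nat.
by move=> e; rewrite (E φ) (E ψ) e.
Qed.

End Disks.

(** * Strictification: formal composites of proarrows and their action *)

Inductive pexp {D : double_category} : D -> D -> Type :=
| Atom A B of pro A B : pexp A B
| Cat A B C of pexp A B & pexp B C : pexp A C.

Section Strictification.
Context {D : double_category}.
Implicit Types A B Z : D.

Fixpoint peval A B (e : pexp A B) : pro A B :=
  match e with
  | Atom m => m
  | Cat e1 e2 => peval e1 ⊙ peval e2
  end.

(** Unlike [peval], this forgets brackets: the two bracketings of a triple [Cat] act by convertible
    proarrows. *)
Fixpoint pact A B (e : pexp A B) : forall Z, pro B Z -> pro A Z :=
  match e with
  | Atom m => fun Z t => m ⊙ t
  | Cat e1 e2 => fun Z t => pact e1 (pact e2 t)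
  end.

Fixpoint pmap A B (e : pexp A B) :
    forall Z (t t' : pro B Z), disk t t' -> disk (pact e t) (pact e t') :=
  match e in pexp A B return
    forall Z (t t' : pro B Z), disk t t' -> disk (pact e t) (pact e t') with
  | Atom m => fun Z t t' τ => hid m ⊙⊙ τ
  | Cat e1 e2 => fun Z t t' τ => pmap e1 (pmap e2 τ)
  end.

Fixpoint pact_iso A B (e : pexp A B) :
    forall Z (t : pro B Z), diso (peval e ⊙ t) (pact e t) :=
  match e in pexp A B return
    forall Z (t : pro B Z), diso (peval e ⊙ t) (pact e t) with
  | Atom m => fun Z t => diso_id (m ⊙ t)
  | Cat e1 e2 => fun Z t =>
      assoc (peval e1) (peval e2) t
      ;; (diso_id (peval e1) ⊗ pact_iso e2 t)
      ;; pact_iso e1 (pact e2 t)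
  end.

Lemma pact_iso_Cat A B C (e1 : pexp A B) (e2 : pexp B C) Z (t : pro C Z) :
  pact_iso (Cat e1 e2) t
  = assoc (peval e1) (peval e2) t
    ;; (diso_id (peval e1) ⊗ pact_iso e2 t)
    ;; pact_iso e1 (pact e2 t).
Proof. by []. Qed.

(* [φ ⊙ t] with its boundaries reassociated to the right; locked, lest
   unification unfold it to a composite of disks. *)
Fact whisk_key : unit. Proof. exact: tt. Qed.

Definition whisk A B (e e' : pexp A B) (φ : disk (peval e) (peval e')) Z
    (t : pro B Z) : disk (pact e t) (pact e' t) :=
  locked_with whisk_key
    (bwd (pact_iso e t) » (φ ⊙⊙ hid t) » fwd (pact_iso e' t)).

Lemma whisk_def A B (e e' : pexp A B) (φ : disk (peval e) (peval e')) Z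
    (t : pro B Z) :
  whisk φ t = bwd (pact_iso e t) » (φ ⊙⊙ hid t) » fwd (pact_iso e' t).
Proof. by rewrite /whisk locked_withE. Qed.

Lemma pact_iso_nat A B (e : pexp A B) Z (t t' : pro B Z) (τ : disk t t') :
  (hid (peval e) ⊙⊙ τ) » fwd (pact_iso e t')
  = fwd (pact_iso e t) » pmap e τ.
Proof.
elim: e Z t t' τ => [{}A {}B m|{}A {}B C e1 IH1 e2 IH2] Z t t' τ.
  by rewrite /= dcomp_idl dcomp_idr.
rewrite !(pact_iso_Cat e1 e2) !disoE -!dcompA.
rewrite -[peval (Cat _ _)]/(peval e1 ⊙ peval e2) -vcomp_hid.
rewrite dcompA assoc_nat -!dcompA; congr (_ » _).
by rewrite (dcompA (_ ⊙⊙ _)) -vcomp_dcompl IH2 vcomp_dcompl -dcompA IH1.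
Qed.

Lemma pmap_id A B (e : pexp A B) Z (t : pro B Z) :
  pmap e (hid t) = hid (pact e t).
Proof.
by elim: e Z t => [{}A {}B m|{}A {}B C e1 IH1 e2 IH2] Z t;
  rewrite /= ?vcomp_hid ?IH2 ?IH1.
Qed.

Lemma whiskE A B (e e' : pexp A B) (φ : disk (peval e) (peval e')) Z
    (t : pro B Z) :
  (φ ⊙⊙ hid t) » fwd (pact_iso e' t) = fwd (pact_iso e t) » whisk φ t.
Proof. by rewrite whisk_def fwdKr. Qed.

(** As [pact_iso] is invertible, the commuting square of [whiskE] characterizes [whisk φ t].
    Vertical composites and associators are treated through this property. *)
Lemma whiskP A B (e e' : pexp A B) (φ : disk (peval e) (peval e')) Z
    (t : pro B Z) (χ : disk (pact e t) (pact e' t)) :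
  (φ ⊙⊙ hid t) » fwd (pact_iso e' t) = fwd (pact_iso e t) » χ ->
  whisk φ t = χ.
Proof. by rewrite whisk_def => ->; rewrite bwdKr. Qed.

Lemma whisk_inj A B (e e' : pexp A B) (φ ψ : disk (peval e) (peval e')) :
  whisk φ (punit B) = whisk ψ (punit B) -> φ = ψ.
Proof.
move=> e_; apply: vcomp_punit_inj.
rewrite -[LHS]dcomp_idr -[RHS]dcomp_idr -(fwdK (pact_iso e' _)).
by rewrite !dcompA !whiskE e_.
Qed.

Lemma whisk_id A B (e : pexp A B) Z (t : pro B Z) :
  whisk (hid (peval e)) t = hid (pact e t).
Proof. by rewrite whisk_def vcomp_hid dcomp_idl bwdK. Qed.

Lemma whisk_comp A B (e e' e'' : pexp A B)
    (φ : disk (peval e) (peval e')) (ψ : disk (peval e') (peval e'')) Z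
    (t : pro B Z) :
  whisk (φ » ψ) t = whisk φ t » whisk ψ t.
Proof. by rewrite !whisk_def vcomp_dcompr -!dcompA fwdKr. Qed.

Lemma whisk_fwdK A B (e e' : pexp A B) (i : diso (peval e) (peval e')) Z
    (t : pro B Z) :
  whisk (fwd i) t » whisk (bwd i) t = hid (pact e t).
Proof. by rewrite -whisk_comp fwdK whisk_id. Qed.

Lemma whisk_bwdK A B (e e' : pexp A B) (i : diso (peval e) (peval e')) Z
    (t : pro B Z) :
  whisk (bwd i) t » whisk (fwd i) t = hid (pact e' t).
Proof. by rewrite -whisk_comp bwdK whisk_id. Qed.

(** A disk acting on the head slides past one acting on the tail: [pact_iso] is natural in the tail,
    and the rest is the interchange law. *)
Lemma whisk_nat A B (e e' : pexp A B) (φ : disk (peval e) (peval e')) Z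
    (t t' : pro B Z) (τ : disk t t') :
  whisk φ t » pmap e' τ = pmap e τ » whisk φ t'.
Proof.
rewrite -[RHS](bwdKr (pact_iso e t)) (dcompA (fwd _)) -pact_iso_nat !whisk_def.
rewrite -!dcompA -pact_iso_nat fwdKr; congr (_ » _).
by rewrite !(dcompA (_ ⊙⊙ _)) vcomp_swap.
Qed.

(** The right factor is absorbed into the tail on which [φ] acts. *)
Lemma whisk_vcompl A B C (e1 e1' : pexp A B) (e2 : pexp B C)
    (φ : disk (peval e1) (peval e1')) Z (t : pro C Z) :
  @whisk _ _ (Cat e1 e2) (Cat e1' e2) (φ ⊙⊙ hid (peval e2)) Z t
  = whisk φ (pact e2 t).
Proof.
apply: whiskP; rewrite !pact_iso_Cat !disoE -!dcompA.
rewrite dcompA assoc_nat -!dcompA; congr (_ » _).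
rewrite vcomp_hid dcompA vcomp_swap -dcompA; congr (_ » _).
exact: whiskE.
Qed.

Lemma whisk_vcompr A B C (e1 : pexp A B) (e2 e2' : pexp B C)
    (ψ : disk (peval e2) (peval e2')) Z (t : pro C Z) :
  @whisk _ _ (Cat e1 e2) (Cat e1 e2') (hid (peval e1) ⊙⊙ ψ) Z t
  = pmap e1 (whisk ψ t).
Proof.
apply: whiskP; rewrite !pact_iso_Cat !disoE -!dcompA.
rewrite dcompA assoc_nat -!dcompA; congr (_ » _).
by rewrite dcompA -vcomp_dcompl whiskE vcomp_dcompl -dcompA pact_iso_nat.
Qed.

Lemma whisk_vcomp A B C (e1 e1' : pexp A B) (e2 e2' : pexp B C)
    (φ : disk (peval e1) (peval e1')) (ψ : disk (peval e2) (peval e2')) Z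
    (t : pro C Z) :
  @whisk _ _ (Cat e1 e2) (Cat e1' e2') (φ ⊙⊙ ψ) Z t
  = whisk φ (pact e2 t) » pmap e1' (whisk ψ t).
Proof.
rewrite -(dcomp_idr φ) -(dcomp_idl ψ) -dcomp_vcomp.
rewrite (@whisk_comp _ _ _ (Cat e1' e2)) whisk_vcompl whisk_vcompr.
by rewrite dcomp_idr dcomp_idl.
Qed.

(** The identity is well typed because both bracketings act alike; the equation is the pentagon,
    followed by naturality of the associator. *)
Lemma whisk_assoc A B C E (a : pexp A B) (b : pexp B C) (c : pexp C E) Z
    (t : pro E Z) :
  @whisk _ _ (Cat (Cat a b) c) (Cat a (Cat b c))
    (fwd (assoc (peval a) (peval b) (peval c))) Z t
  = hid (pact a (pact b (pact c t))).
Proof.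
apply: whiskP; rewrite dcomp_idr.
rewrite !(pact_iso_Cat, disoE) !vcomp_dcompl -!dcompA.
rewrite (dcompA (fwd _) (_ ⊙⊙ fwd (assoc _ _ _))) dcompA pentagon -!dcompA.
congr (_ » _).
rewrite -[peval (Cat a b)]/(peval a ⊙ peval b) -(vcomp_hid (peval a)).
by rewrite [RHS]dcompA assoc_nat -dcompA.
Qed.

Lemma whisk_assoc_inv A B C E (a : pexp A B) (b : pexp B C) (c : pexp C E) Z
    (t : pro E Z) :
  @whisk _ _ (Cat a (Cat b c)) (Cat (Cat a b) c)
    (bwd (assoc (peval a) (peval b) (peval c))) Z t
  = hid (pact a (pact b (pact c t))).
Proof.
have := @whisk_comp _ _ (Cat a (Cat b c)) (Cat (Cat a b) c)
  (Cat a (Cat b c)) (bwd (assoc _ _ _)) (fwd (assoc _ _ _)) Z t.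
by rewrite bwdK (@whisk_id _ _ (Cat a (Cat b c))) whisk_assoc dcomp_idr.
Qed.

End Strictification.

(** * Pasting diagrams for the composite, and their comparison at [m ⊙ n] *)

Section Pasting.
Context {D : double_category}.

(** The disk of the composite at a proarrow [m : A → B], with [i], [j], [k] in the roles of αm, β(m,
    B), β(A, m). *)
Definition comp_disk {S P Q R P' Q' Q1 R1 Q1' : D}
    {f : pro S P} {a : pro P Q} {g : pro Q R}
    {f' : pro S P'} {a' : pro P' Q'} {g' : pro Q' R}
    {b : pro Q Q1} {c : pro R R1} {b' : pro Q' Q1'}
    {h : pro Q1 R1} {h' : pro Q1' R1}
    (i : diso (f ⊙ a ⊙ g) (f' ⊙ a' ⊙ g'))
    (j : diso (g ⊙ c) (b ⊙ h)) (k : diso (g' ⊙ c) (b' ⊙ h')) :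
    diso (f ⊙ (a ⊙ b) ⊙ h) (f' ⊙ (a' ⊙ b') ⊙ h') :=
  (diso_id f ⊗ assoc a b h)
  ;; (diso_id f ⊗ (diso_id a ⊗ diso_inv j))
  ;; (diso_id f ⊗ diso_inv (assoc a g c))
  ;; diso_inv (assoc f (a ⊙ g) c)
  ;; (i ⊗ diso_id c)
  ;; assoc f' (a' ⊙ g') c
  ;; (diso_id f' ⊗ assoc a' g' c)
  ;; (diso_id f' ⊗ (diso_id a' ⊗ k))
  ;; (diso_id f' ⊗ diso_inv (assoc a' b' h')).

(** The composite in the axiom [npro_pcomp], with [j], [k] as the components at the two factors,
    transported along [s] and [t] to proarrows that are only isomorphic to composites. *)
Definition nat_paste {X Y Z X1 Y1 Z1 : D} {g : pro X Z} {p : pro X Y}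
    {q : pro Y Z} {h : pro X1 Z1} {p' : pro X1 Y1} {q' : pro Y1 Z1}
    {b : pro X X1} {b' : pro Y Y1} {b'' : pro Z Z1}
    (s : diso g (p ⊙ q)) (j : diso (p ⊙ b') (b ⊙ p'))
    (k : diso (q ⊙ b'') (b' ⊙ q')) (t : diso h (p' ⊙ q')) :
    diso (g ⊙ b'') (b ⊙ h) :=
  (s ⊗ diso_id b'')
  ;; (assoc p q b''
      ;; (diso_id p ⊗ k)
      ;; diso_inv (assoc p b' q')
      ;; (j ⊗ diso_id q')
      ;; assoc b p' q')
  ;; (diso_id b ⊗ diso_inv t).

(* The composite in the axiom [dpro_pcomp], where [fEm], [fnB] stand for
   F(E, m), F(n, B), and [fE], [fA] for F(E, m ⊙ n), F(m ⊙ n, A). *)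
Definition dinat_paste {X0 X1 X2 X3 X4 X5 Y0 Y1 Y2 Y3 Y4 Y5 : D}
    {fE : pro X0 X2} {fEm : pro X0 X1} {fEn : pro X1 X2}
    {fnB : pro X1 X3} {fnA : pro X0 X4} {fBm : pro X4 X3}
    {fmA : pro X4 X5} {fA : pro X0 X5}
    {aE : pro X2 Y2} {aB : pro X3 Y3} {aA : pro X5 Y5}
    {gE : pro Y2 Y0} {gnE : pro Y2 Y1} {gmE : pro Y1 Y0}
    {gBn : pro Y3 Y1} {gmB : pro Y3 Y4} {gAn : pro Y4 Y0}
    {gAm : pro Y5 Y4} {gA : pro Y5 Y0}
    (sF : diso fE (fEm ⊙ fEn)) (sG : diso gE (gnE ⊙ gmE))
    (dn : diso (fEn ⊙ aE ⊙ gnE) (fnB ⊙ aB ⊙ gBn))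
    (iF : diso (fEm ⊙ fnB) (fnA ⊙ fBm)) (iG : diso (gBn ⊙ gmE) (gmB ⊙ gAn))
    (dm : diso (fBm ⊙ aB ⊙ gmB) (fmA ⊙ aA ⊙ gAm))
    (tF : diso fA (fnA ⊙ fmA)) (tG : diso gA (gAm ⊙ gAn)) :
    diso (fE ⊙ aE ⊙ gE) (fA ⊙ aA ⊙ gA) :=
  (sF ⊗ (diso_id aE ⊗ sG))
  ;; nest _ _ _ _ _
  ;; (diso_id fEm ⊗ (dn ⊗ diso_id gmE))
  ;; diso_inv (nest _ _ _ _ _)
  ;; (iF ⊗ (diso_id aB ⊗ iG))
  ;; nest _ _ _ _ _
  ;; (diso_id fnA ⊗ (dm ⊗ diso_id gAn))
  ;; diso_inv (nest _ _ _ _ _)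
  ;; (diso_inv tF ⊗ (diso_id aA ⊗ diso_inv tG)).

(** [whisk_comp] needs a formal composite for the intermediate boundary of a [dcomp]; unification
    would have to invert [peval], so it is read off the syntax. *)
Ltac reify m :=
  lazymatch m with
  | peval ?e => e
  | ?p ⊙ ?q => let e1 := reify p in let e2 := reify q in constr:(Cat e1 e2)
  | _ => constr:(Atom m)
  end.

Ltac whisk_step :=
  match goal with
  | |- context [@whisk ?D ?A ?B ?e ?e'' (@dcomp _ _ _ _ ?n _ ?φ ?ψ) ?Z ?t] =>
    let e' := reify n in rewrite (@whisk_comp D A B e e' e'' φ ψ Z t)
  | |- context [@whisk ?D ?A ?C (@Cat _ _ ?B _ ?e1 ?e2) (Cat ?e1' ?e2')
                  (?φ ⊙⊙ ?ψ) ?Z ?t] =>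
    rewrite (@whisk_vcomp D A B C e1 e1' e2 e2' φ ψ Z t)
  | |- context [@whisk ?D ?A ?B ?e _ (hid _) ?Z ?t] =>
    rewrite (@whisk_id D A B e Z t)
  | |- context [@whisk ?D ?A ?E (Cat (Cat ?a ?b) ?c) _
                  (fwd (assoc _ _ _)) ?Z ?t] =>
    rewrite (@whisk_assoc D A _ _ E a b c Z t)
  | |- context [@whisk ?D ?A ?E (Cat ?a (Cat ?b ?c)) _
                  (bwd (assoc _ _ _)) ?Z ?t] =>
    rewrite (@whisk_assoc_inv D A _ _ E a b c Z t)
  end.

(** The digits count the atoms of the source and of the target, bracketed to the right. *)
Local Notation whisk12 φ t :=
  (@whisk _ _ _ (Atom _) (Cat (Atom _) (Atom _)) φ _ t).
Local Notation whisk21 φ t :=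
  (@whisk _ _ _ (Cat (Atom _) (Atom _)) (Atom _) φ _ t).
Local Notation whisk22 φ t :=
  (@whisk _ _ _ (Cat (Atom _) (Atom _)) (Cat (Atom _) (Atom _)) φ _ t).
Local Notation whisk33 φ t :=
  (@whisk _ _ _ (Cat (Atom _) (Cat (Atom _) (Atom _)))
     (Cat (Atom _) (Cat (Atom _) (Atom _))) φ _ t).

Ltac strictify :=
  rewrite ?disoE; repeat whisk_step; cbn [pmap pact peval];
  rewrite ?(pmap_id, vcomp_hid, dcomp_idl, dcomp_idr).

Lemma whisk_comp_disk {S P Q R P' Q' Q1 R1 Q1' Z : D}
    {f : pro S P} {a : pro P Q} {g : pro Q R}
    {f' : pro S P'} {a' : pro P' Q'} {g' : pro Q' R}
    {b : pro Q Q1} {c : pro R R1} {b' : pro Q' Q1'}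
    {h : pro Q1 R1} {h' : pro Q1' R1}
    (i : diso (f ⊙ a ⊙ g) (f' ⊙ a' ⊙ g'))
    (j : diso (g ⊙ c) (b ⊙ h)) (k : diso (g' ⊙ c) (b' ⊙ h')) (t : pro R1 Z) :
  @whisk _ _ _ (Cat (Atom _) (Cat (Cat (Atom _) (Atom _)) (Atom _)))
    (Cat (Atom _) (Cat (Cat (Atom _) (Atom _)) (Atom _)))
    (fwd (comp_disk i j k)) _ t
  = (hid f ⊙⊙ (hid a ⊙⊙ whisk22 (bwd j) t))
    » whisk33 (fwd i) (c ⊙ t)
    » (hid f' ⊙⊙ (hid a' ⊙⊙ whisk22 (fwd k) t)).
Proof. by rewrite /comp_disk; strictify; rewrite -!dcompA. Qed.

(** [g] and [h] are formal composites so as to cover both a single proarrow and the two-factor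
    boundary of an interchange. *)
Lemma whisk_nat_paste {X Y Z X1 Y1 Z1 T : D} {g : pexp X Z} {p : pro X Y}
    {q : pro Y Z} {h : pexp X1 Z1} {p' : pro X1 Y1} {q' : pro Y1 Z1}
    {b : pro X X1} {b' : pro Y Y1} {b'' : pro Z Z1}
    (s : diso (peval g) (p ⊙ q)) (j : diso (p ⊙ b') (b ⊙ p'))
    (k : diso (q ⊙ b'') (b' ⊙ q')) (u : diso (peval h) (p' ⊙ q'))
    (t : pro Z1 T) :
  @whisk _ _ _ (Cat g (Atom b'')) (Cat (Atom b) h) (fwd (nat_paste s j k u)) _ t
  = @whisk _ _ _ g (Cat (Atom p) (Atom q)) (fwd s) _ (b'' ⊙ t)
    » (hid p ⊙⊙ whisk22 (fwd k) t)
    » whisk22 (fwd j) (q' ⊙ t)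
    » (hid b ⊙⊙ @whisk _ _ _ (Cat (Atom p') (Atom q')) h (bwd u) _ t).
Proof. by rewrite /nat_paste; strictify; rewrite -!dcompA. Qed.

Lemma whisk_nat_paste_inv {X Y Z X1 Y1 Z1 T : D} {g : pro X Z} {p : pro X Y}
    {q : pro Y Z} {h : pro X1 Z1} {p' : pro X1 Y1} {q' : pro Y1 Z1}
    {b : pro X X1} {b' : pro Y Y1} {b'' : pro Z Z1}
    (s : diso g (p ⊙ q)) (j : diso (p ⊙ b') (b ⊙ p'))
    (k : diso (q ⊙ b'') (b' ⊙ q')) (u : diso h (p' ⊙ q')) (t : pro Z1 T) :
  whisk22 (bwd (nat_paste s j k u)) t
  = (hid b ⊙⊙ whisk12 (fwd u) t)
    » whisk22 (bwd j) (q' ⊙ t) » (hid p ⊙⊙ whisk22 (bwd k) t)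
    » whisk21 (bwd s) (b'' ⊙ t).
Proof. by rewrite /nat_paste; strictify; rewrite -!dcompA. Qed.

(** [aE], [aB], [aA] are formal composites because they stand for components both of α and of α ⊙
    β. *)
Lemma whisk_dinat_paste {X0 X1 X2 X3 X4 X5 Y0 Y1 Y2 Y3 Y4 Y5 T : D}
    {fE : pro X0 X2} {fEm : pro X0 X1} {fEn : pro X1 X2}
    {fnB : pro X1 X3} {fnA : pro X0 X4} {fBm : pro X4 X3}
    {fmA : pro X4 X5} {fA : pro X0 X5}
    {aE : pexp X2 Y2} {aB : pexp X3 Y3} {aA : pexp X5 Y5}
    {gE : pro Y2 Y0} {gnE : pro Y2 Y1} {gmE : pro Y1 Y0}
    {gBn : pro Y3 Y1} {gmB : pro Y3 Y4} {gAn : pro Y4 Y0}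
    {gAm : pro Y5 Y4} {gA : pro Y5 Y0}
    (sF : diso fE (fEm ⊙ fEn)) (sG : diso gE (gnE ⊙ gmE))
    (dn : diso (fEn ⊙ peval aE ⊙ gnE) (fnB ⊙ peval aB ⊙ gBn))
    (iF : diso (fEm ⊙ fnB) (fnA ⊙ fBm)) (iG : diso (gBn ⊙ gmE) (gmB ⊙ gAn))
    (dm : diso (fBm ⊙ peval aB ⊙ gmB) (fmA ⊙ peval aA ⊙ gAm))
    (tF : diso fA (fnA ⊙ fmA)) (tG : diso gA (gAm ⊙ gAn)) (t : pro Y0 T) :
  @whisk _ _ _ (Cat (Atom _) (Cat aE (Atom _)))
     (Cat (Atom _) (Cat aA (Atom _)))
     (fwd (dinat_paste sF sG dn iF iG dm tF tG)) _ t
  = whisk12 (fwd sF) _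
    » (hid fEm ⊙⊙ (hid fEn ⊙⊙ pmap aE (whisk12 (fwd sG) t)))
    » (hid fEm ⊙⊙ @whisk _ _ _ (Cat (Atom _) (Cat aE (Atom _)))
                    (Cat (Atom _) (Cat aB (Atom _))) (fwd dn) _ (gmE ⊙ t))
    » whisk22 (fwd iF) _
    » (hid fnA ⊙⊙ (hid fBm ⊙⊙ pmap aB (whisk22 (fwd iG) t)))
    » (hid fnA ⊙⊙ @whisk _ _ _ (Cat (Atom _) (Cat aB (Atom _)))
                    (Cat (Atom _) (Cat aA (Atom _))) (fwd dm) _ (gAn ⊙ t))
    » whisk21 (bwd tF) _
    » (hid fA ⊙⊙ pmap aA (whisk21 (bwd tG) t)).
Proof. by rewrite /dinat_paste /nest; strictify; rewrite -!dcompA. Qed.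

(** This and the next three are instances of [whisk_nat] with [pact] and [pmap] computed away, the
    form in which disks are slid below. *)
Lemma whisk12_nat {X Y Z T : D} {m : pro X Z} {p : pro X Y} {q : pro Y Z}
    {t t' : pro Z T} (φ : disk m (p ⊙ q)) (τ : disk t t') :
  whisk12 φ t » (hid p ⊙⊙ (hid q ⊙⊙ τ)) = (hid m ⊙⊙ τ) » whisk12 φ t'.
Proof.
exact: (@whisk_nat _ _ _ (Atom _) (Cat (Atom _) (Atom _)) φ).
Qed.

Lemma whisk21_nat {X Y Z T : D} {m : pro X Z} {p : pro X Y} {q : pro Y Z}
    {t t' : pro Z T} (φ : disk (p ⊙ q) m) (τ : disk t t') :
  whisk21 φ t » (hid m ⊙⊙ τ) = (hid p ⊙⊙ (hid q ⊙⊙ τ)) » whisk21 φ t'.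
Proof.
exact: (@whisk_nat _ _ _ (Cat (Atom _) (Atom _)) (Atom _) φ).
Qed.

Lemma whisk22_nat {X Y Y' Z T : D} {p : pro X Y} {q : pro Y Z}
    {p' : pro X Y'} {q' : pro Y' Z} {t t' : pro Z T}
    (φ : disk (p ⊙ q) (p' ⊙ q')) (τ : disk t t') :
  whisk22 φ t » (hid p' ⊙⊙ (hid q' ⊙⊙ τ))
  = (hid p ⊙⊙ (hid q ⊙⊙ τ)) » whisk22 φ t'.
Proof.
exact: (@whisk_nat _ _ _ (Cat (Atom _) (Atom _)) (Cat (Atom _) (Atom _)) φ).
Qed.

Lemma whisk33_nat {X Y Y' Z Z' W T : D} {p : pro X Y} {q : pro Y Z}
    {r : pro Z W} {p' : pro X Y'} {q' : pro Y' Z'} {r' : pro Z' W}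
    {t t' : pro W T} (φ : disk (p ⊙ q ⊙ r) (p' ⊙ q' ⊙ r')) (τ : disk t t') :
  whisk33 φ t » (hid p' ⊙⊙ (hid q' ⊙⊙ (hid r' ⊙⊙ τ)))
  = (hid p ⊙⊙ (hid q ⊙⊙ (hid r ⊙⊙ τ))) » whisk33 φ t'.
Proof.
exact: (@whisk_nat _ _ _ (Cat (Atom _) (Cat (Atom _) (Atom _)))
         (Cat (Atom _) (Cat (Atom _) (Atom _))) φ).
Qed.

(* Read [gmE] as G(m, E), [gBn] as G(B, n), and so on for [f], [h] and [j] (= β);
   [gE] is G(m ⊙ n, E), [gA] is G(A, m ⊙ n), and [b1], [b0], [b4] are β(B, E),
   β(A, E), β(A, B), while [b2], [b3], [b5] are β at the diagonal pairs. *)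
Lemma comp_disk_paste
    (X0 X1 X2 X3 X4 X5 Y0 Y1 Y2 Y3 Y4 Y5 Z0 Z1 Z2 Z3 Z4 Z5 : D)
    (fE : pro X0 X2) (fEm : pro X0 X1) (fEn : pro X1 X2)
    (fnB : pro X1 X3) (fnA : pro X0 X4) (fBm : pro X4 X3)
    (fmA : pro X4 X5) (fA : pro X0 X5)
    (aE : pro X2 Y2) (aB : pro X3 Y3) (aA : pro X5 Y5)
    (gE : pro Y2 Y0) (gnE : pro Y2 Y1) (gmE : pro Y1 Y0)
    (gBn : pro Y3 Y1) (gmB : pro Y3 Y4) (gAn : pro Y4 Y0)
    (gAm : pro Y5 Y4) (gA : pro Y5 Y0)
    (sF : diso fE (fEm ⊙ fEn)) (sG : diso gE (gnE ⊙ gmE))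
    (dn : diso (fEn ⊙ aE ⊙ gnE) (fnB ⊙ aB ⊙ gBn))
    (iF : diso (fEm ⊙ fnB) (fnA ⊙ fBm)) (iG : diso (gBn ⊙ gmE) (gmB ⊙ gAn))
    (dm : diso (fBm ⊙ aB ⊙ gmB) (fmA ⊙ aA ⊙ gAm))
    (tF : diso fA (fnA ⊙ fmA)) (tG : diso gA (gAm ⊙ gAn))
    (b0 : pro Y0 Z0) (b1 : pro Y1 Z1) (b2 : pro Y2 Z2) (b3 : pro Y3 Z3)
    (b4 : pro Y4 Z4) (b5 : pro Y5 Z5)
    (hE : pro Z2 Z0) (hnE : pro Z2 Z1) (hmE : pro Z1 Z0)
    (hBn : pro Z3 Z1) (hmB : pro Z3 Z4) (hAn : pro Z4 Z0)
    (hAm : pro Z5 Z4) (hA : pro Z5 Z0)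
    (sH : diso hE (hnE ⊙ hmE)) (iH : diso (hBn ⊙ hmE) (hmB ⊙ hAn))
    (tH : diso hA (hAm ⊙ hAn))
    (jnE : diso (gnE ⊙ b1) (b2 ⊙ hnE)) (jmE : diso (gmE ⊙ b0) (b1 ⊙ hmE))
    (jBn : diso (gBn ⊙ b1) (b3 ⊙ hBn)) (jmB : diso (gmB ⊙ b4) (b3 ⊙ hmB))
    (jAn : diso (gAn ⊙ b0) (b4 ⊙ hAn)) (jAm : diso (gAm ⊙ b4) (b5 ⊙ hAm))
    (jE : diso (gE ⊙ b0) (b2 ⊙ hE)) (jA : diso (gA ⊙ b0) (b5 ⊙ hA)) :
  fwd jE = fwd (nat_paste sG jnE jmE sH) ->
  fwd jA = fwd (nat_paste tG jAm jAn tH) ->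
  fwd (nat_paste (diso_id (gBn ⊙ gmE)) jBn jmE (diso_id (hBn ⊙ hmE)))
  = fwd (nat_paste iG jmB jAn iH) ->
  fwd (comp_disk (dinat_paste sF sG dn iF iG dm tF tG) jE jA)
  = fwd (dinat_paste sF sH (comp_disk dn jnE jBn) iF iH
           (comp_disk dm jmB jAm) tF tH).
Proof.
(* [comp_disk] contains [jE] inverted, so its hypothesis is carried over to inverses. *)
move=> /diso_inv_uniq eE eA eI.
pose U := punit Z0.
(* The interchange hypothesis, strictified, with the inverse of [iH] moved to the other side. *)
have {}eI : (hid gBn ⊙⊙ whisk22 (fwd jmE) U) » whisk22 (fwd jBn) (hmE ⊙ U)
    » (hid b3 ⊙⊙ whisk22 (fwd iH) U)
    = whisk22 (fwd iG) (b0 ⊙ U) » (hid gmB ⊙⊙ whisk22 (fwd jAn) U)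
    » whisk22 (fwd jmB) (hAn ⊙ U).
  move: eI => /(congr1 (fun φ => @whisk _ _ _
    (Cat (Cat (Atom gBn) (Atom gmE)) (Atom b0))
    (Cat (Atom b3) (Cat (Atom hBn) (Atom hmE))) φ _ U)).
  rewrite !whisk_nat_paste disoE disoE.
  rewrite (@whisk_id _ _ _ (Cat (Atom gBn) (Atom gmE))).
  rewrite (@whisk_id _ _ _ (Cat (Atom hBn) (Atom hmE))).
  cbn [pact]; rewrite vcomp_hid dcomp_idl dcomp_idr => e.
  rewrite dcompA e -!dcompA -vcomp_dcompl.
  rewrite (@whisk_bwdK _ _ _ (Cat (Atom hBn) (Atom hmE))
    (Cat (Atom hmB) (Atom hAn))).
  by rewrite vcomp_hid dcomp_idr.
apply: (@whisk_inj _ _ _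
  (Cat (Atom fE) (Cat (Cat (Atom aE) (Atom b2)) (Atom hE)))
  (Cat (Atom fA) (Cat (Cat (Atom aA) (Atom b5)) (Atom hA)))).
rewrite -/U whisk_comp_disk eE eA whisk_nat_paste_inv.
rewrite (whisk_nat_paste (g := Atom gA) (h := Atom hA)).
rewrite (whisk_dinat_paste (aE := Atom aE) (aB := Atom aB) (aA := Atom aA)).
rewrite (whisk_dinat_paste (aE := Cat (Atom aE) (Atom b2))
  (aB := Cat (Atom aB) (Atom b3)) (aA := Cat (Atom aA) (Atom b5))).
rewrite !whisk_comp_disk; cbn [pmap pact].
rewrite !vcomp_dcompl -!dcompA.
(* The same hexagon with [jmE] and [jmB] moved across as inverses, in the context where the pasting
   needs it. *)
have {}eI T (χ : disk _ T) :
    (hid fnA ⊙⊙ (hid fBm ⊙⊙ (hid aB ⊙⊙ whisk22 (fwd jBn) (hmE ⊙ U))))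
    » (hid fnA ⊙⊙ (hid fBm ⊙⊙ (hid aB ⊙⊙ (hid b3 ⊙⊙ whisk22 (fwd iH) U))))
    » (hid fnA ⊙⊙ (hid fBm ⊙⊙ (hid aB ⊙⊙ whisk22 (bwd jmB) (hAn ⊙ U)))) » χ
    = (hid fnA ⊙⊙ (hid fBm ⊙⊙ (hid aB ⊙⊙ (hid gBn ⊙⊙ whisk22 (bwd jmE) U))))
    » (hid fnA ⊙⊙ (hid fBm ⊙⊙ (hid aB ⊙⊙ whisk22 (fwd iG) (b0 ⊙ U))))
    » (hid fnA ⊙⊙ (hid fBm ⊙⊙ (hid aB ⊙⊙ (hid gmB ⊙⊙ whisk22 (fwd jAn) U))))
    » χ.
  rewrite !dcompA -!vcomp_dcompl -!dcompA; congr (_ » _); do 3!congr (_ ⊙⊙ _).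
  rewrite -[LHS]dcomp_idl -vcomp_hid.
  rewrite -(@whisk_bwdK _ _ _ (Cat (Atom gmE) (Atom b0))
    (Cat (Atom b1) (Atom hmE)) jmE).
  rewrite vcomp_dcompl -dcompA; congr (_ » _).
  rewrite !dcompA -(dcompA _ _ (_ ⊙⊙ _)) eI -!dcompA.
  rewrite (@whisk_fwdK _ _ _ (Cat (Atom gmB) (Atom b4))
    (Cat (Atom b3) (Atom hmB)) jmB).
  by rewrite dcomp_idr.
(* Sliding [sF] to the front makes the inverse of [sG] meet [sG]; that pair and the one for [tG]
   then cancel. *)
rewrite -!(dcomp_eqr (whisk12_nat (fwd sF) _)).
rewrite (dcomp_cancel
  (vcomp_idl fEm (vcomp_idl fEn (vcomp_idl aE
     (@whisk_bwdK _ _ _ (Atom gE) (Cat (Atom gnE) (Atom gmE)) sG _ _))))).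
rewrite (dcomp_cancel (vcomp_idl fA (vcomp_idl aA
     (@whisk_bwdK _ _ _ (Atom gA) (Cat (Atom gAm) (Atom gAn)) tG _ _)))).
(* The inverse of [tF] slides to the very end on both sides. *)
rewrite !(dcomp_eqr (whisk21_nat (bwd tF) _)) whisk21_nat.
do 3!congr (_ » _).
(* The inverse of [jmE] slides past [dn] and [iF] on the left, [jBn] past [iF] on the right; this
   brings the right side to the hexagon [eI]. Then only [jAn] has to pass [dm]. *)
rewrite -(dcomp_eqr (vcomp_eql _ (whisk33_nat (fwd dn) _))); congr (_ » _).
rewrite -!(dcomp_eqr (whisk22_nat (fwd iF) _)); congr (_ » _).
rewrite eI; do 2!congr (_ » _).
by rewrite -(dcomp_eqr (vcomp_eql _ (whisk33_nat (fwd dm) _))).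
Qed.

End Pasting.

(** * Naturality of the pasted disk with respect to squares *)

Section Naturality.
Context {D : double_category}.

Lemma vcomp_heq (A B C A' B' C' : D) (m : pro A B) (n : pro B C)
    (m' : pro A' B') (n' : pro B' C') (f f1 : arr A A') (g g1 : arr B B')
    (h h1 : arr C C') (φ : sq m m' f g) (φ1 : sq m m' f1 g1)
    (ψ : sq n n' g h) (ψ1 : sq n n' g1 h1) :
  φ ≡ φ1 -> ψ ≡ ψ1 -> φ ⊙⊙ ψ ≡ φ1 ⊙⊙ ψ1.
Proof.
move=> /heq_castsq[ef [eg e]] H; subst f1 g1 φ1.
by case: (heq_castsq H) => _ [eh _]; subst h1; rewrite (heq4_eq H).
Qed.

Lemma hid_heq (A B : D) (m n : pro A B) : m = n -> hid m ≡ hid n.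
Proof. by move=> ->; apply: sq_refl. Qed.

(** The common shape of the naturality axioms [npro_nat] and [dpro_nat], isolated because it is
    stable under all the operations that build [comp_disk]. *)
Definition natural {A B A' B' : D} {m n : pro A B} {m' n' : pro A' B'}
    {f : arr A A'} {g : arr B B'} (i : diso m n) (i' : diso m' n')
    (φ : sq m m' f g) (ψ : sq n n' f g) : Prop :=
  φ ·· fwd i' ≡ fwd i ·· ψ.

Lemma natural_id (A B A' B' : D) (m : pro A B) (m' : pro A' B')
    (f : arr A A') (g : arr B B') (φ : sq m m' f g) :
  natural (diso_id m) (diso_id m') φ φ.
Proof. exact: heq4_trans (hcomp_idr _) (heq4_sym (hcomp_idl _)). Qed.

Lemma natural_comp (A B A' B' : D) (m n p : pro A B) (m' n' p' : pro A' B')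
    (f : arr A A') (g : arr B B') (i : diso m n) (j : diso n p)
    (i' : diso m' n') (j' : diso n' p')
    (φ : sq m m' f g) (ψ : sq n n' f g) (χ : sq p p' f g) :
  natural i i' φ ψ -> natural j j' ψ χ -> natural (i ;; j) (i' ;; j') φ χ.
Proof.
rewrite /natural !disoE => ei ej.
apply: heq4_trans (hcomp_heq (sq_refl _) (dcomp_heq _ _)) _.
apply: heq4_trans (hcomp_assoc _ _ _) _.
apply: heq4_trans (hcomp_heq ei (sq_refl _)) _.
apply: heq4_trans (heq4_sym (hcomp_assoc _ _ _)) _.
apply: heq4_trans (hcomp_heq (sq_refl _) ej) _.
apply: heq4_trans (hcomp_assoc _ _ _) _.
exact: hcomp_heq (heq4_sym (dcomp_heq _ _)) (sq_refl _).
Qed.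

Lemma natural_inv (A B A' B' : D) (m n : pro A B) (m' n' : pro A' B')
    (f : arr A A') (g : arr B B') (i : diso m n) (i' : diso m' n')
    (φ : sq m m' f g) (ψ : sq n n' f g) :
  natural i i' φ ψ -> natural (diso_inv i) (diso_inv i') ψ φ.
Proof.
rewrite /natural !disoE => e; apply: heq4_sym.
apply: heq4_trans (heq4_sym (hcomp_idr _)) _; rewrite -(fwdK i').
apply: heq4_trans (hcomp_heq (sq_refl _) (dcomp_heq _ _)) _.
apply: heq4_trans (hcomp_assoc _ _ _) _.
apply: hcomp_heq (sq_refl _).
apply: heq4_trans (heq4_sym (hcomp_assoc _ _ _)) _.
apply: heq4_trans (hcomp_heq (sq_refl _) e) _.
apply: heq4_trans (hcomp_assoc _ _ _) _.
apply: heq4_trans (hcomp_heq (heq4_sym (dcomp_heq _ _)) (sq_refl _)) _.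
by rewrite bwdK; apply: hcomp_idl.
Qed.

Lemma natural_vcomp (A B C A' B' C' : D) (m n : pro A B) (p q : pro B C)
    (m' n' : pro A' B') (p' q' : pro B' C') (f : arr A A') (g : arr B B')
    (h : arr C C') (i : diso m n) (j : diso p q)
    (i' : diso m' n') (j' : diso p' q')
    (φ : sq m m' f g) (φ1 : sq n n' f g) (ψ : sq p p' g h) (ψ1 : sq q q' g h) :
  natural i i' φ φ1 -> natural j j' ψ ψ1 ->
  natural (i ⊗ j) (i' ⊗ j') (φ ⊙⊙ ψ) (φ1 ⊙⊙ ψ1).
Proof.
by rewrite /natural !disoE -!vcomp_hcomp => ei ej; apply: vcomp_heq ei ej.
Qed.

Lemma natural_assoc (A B C E A' B' C' E' : D)
    (m : pro A B) (n : pro B C) (p : pro C E)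
    (m' : pro A' B') (n' : pro B' C') (p' : pro C' E')
    (f : arr A A') (g : arr B B') (h : arr C C') (k : arr E E')
    (φ : sq m m' f g) (ψ : sq n n' g h) (χ : sq p p' h k) :
  natural (assoc m n p) (assoc m' n' p')
    ((φ ⊙⊙ ψ) ⊙⊙ χ) (φ ⊙⊙ (ψ ⊙⊙ χ)).
Proof. exact: passoc_nat. Qed.

Lemma natural_comp_disk (S P Q R P1 Q1 Q2 R2 Q3 : D)
    (f : pro S P) (a : pro P Q) (g : pro Q R)
    (f1 : pro S P1) (a1 : pro P1 Q1) (g1 : pro Q1 R)
    (b : pro Q Q2) (c : pro R R2) (b1 : pro Q1 Q3)
    (h : pro Q2 R2) (h1 : pro Q3 R2)
    (i : diso (f ⊙ a ⊙ g) (f1 ⊙ a1 ⊙ g1))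
    (j : diso (g ⊙ c) (b ⊙ h)) (k : diso (g1 ⊙ c) (b1 ⊙ h1))
    (S' P' Q' R' P1' Q1' Q2' R2' Q3' : D)
    (f' : pro S' P') (a' : pro P' Q') (g' : pro Q' R')
    (f1' : pro S' P1') (a1' : pro P1' Q1') (g1' : pro Q1' R')
    (b' : pro Q' Q2') (c' : pro R' R2') (b1' : pro Q1' Q3')
    (h' : pro Q2' R2') (h1' : pro Q3' R2')
    (i' : diso (f' ⊙ a' ⊙ g') (f1' ⊙ a1' ⊙ g1'))
    (j' : diso (g' ⊙ c') (b' ⊙ h')) (k' : diso (g1' ⊙ c') (b1' ⊙ h1'))
    (s : arr S S') (p : arr P P') (q : arr Q Q') (r : arr R R')
    (p1 : arr P1 P1') (q1 : arr Q1 Q1') (q2 : arr Q2 Q2') (r2 : arr R2 R2')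
    (q3 : arr Q3 Q3')
    (φf : sq f f' s p) (φa : sq a a' p q) (φg : sq g g' q r)
    (φf1 : sq f1 f1' s p1) (φa1 : sq a1 a1' p1 q1) (φg1 : sq g1 g1' q1 r)
    (φb : sq b b' q q2) (φc : sq c c' r r2) (φb1 : sq b1 b1' q1 q3)
    (φh : sq h h' q2 r2) (φh1 : sq h1 h1' q3 r2) :
  natural i i' (φf ⊙⊙ φa ⊙⊙ φg) (φf1 ⊙⊙ φa1 ⊙⊙ φg1) ->
  natural j j' (φg ⊙⊙ φc) (φb ⊙⊙ φh) ->
  natural k k' (φg1 ⊙⊙ φc) (φb1 ⊙⊙ φh1) ->
  natural (comp_disk i j k) (comp_disk i' j' k')
    (φf ⊙⊙ (φa ⊙⊙ φb) ⊙⊙ φh) (φf1 ⊙⊙ (φa1 ⊙⊙ φb1) ⊙⊙ φh1).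
Proof.
move=> ei ej ek.
(* The nine factors are peeled off from the last to the first, each determining the square at its
   source. *)
apply: natural_comp _ (natural_vcomp (natural_id φf1)
  (natural_inv (natural_assoc φa1 φb1 φh1))).
apply: natural_comp _ (natural_vcomp (natural_id φf1)
  (natural_vcomp (natural_id φa1) ek)).
apply: natural_comp _ (natural_vcomp (natural_id φf1)
  (natural_assoc φa1 φg1 φc)).
apply: natural_comp _ (natural_assoc φf1 (φa1 ⊙⊙ φg1) φc).
apply: natural_comp _ (natural_vcomp ei (natural_id φc)).
apply: natural_comp _ (natural_inv (natural_assoc φf (φa ⊙⊙ φg) φc)).
apply: natural_comp _ (natural_vcomp (natural_id φf)
  (natural_inv (natural_assoc φa φg φc))).
apply: natural_comp _ (natural_vcomp (natural_id φf)
  (natural_vcomp (natural_id φa) (natural_inv ej))).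
exact: natural_vcomp (natural_id φf) (natural_assoc φa φb φh).
Qed.

(** Once [i] is trivial, the inverse of [j] meets [j]. *)
Lemma comp_disk_id (S P Q R Q1 R1 : D)
    (f : pro S P) (a : pro P Q) (g : pro Q R)
    (b : pro Q Q1) (c : pro R R1) (h : pro Q1 R1)
    (i : diso (f ⊙ a ⊙ g) (f ⊙ a ⊙ g)) (j : diso (g ⊙ c) (b ⊙ h)) :
  fwd i = hid _ -> fwd (comp_disk i j j) = hid _.
Proof.
move=> ei.
apply: (@whisk_inj _ _ _
  (Cat (Atom f) (Cat (Cat (Atom a) (Atom b)) (Atom h)))
  (Cat (Atom f) (Cat (Cat (Atom a) (Atom b)) (Atom h)))).
rewrite whisk_comp_disk ei (@whisk_id _ _ _ (Cat (Atom _) (Cat (Atom _) (Atom _)))).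
rewrite (@whisk_id _ _ _ (Cat (Atom f) (Cat (Cat (Atom a) (Atom b)) (Atom h)))).
rewrite dcomp_idl -!vcomp_dcompl.
by rewrite (@whisk_bwdK _ _ _ (Cat (Atom g) (Atom c)) (Cat (Atom b) (Atom h)))
  !vcomp_hid.
Qed.

End Naturality.

(** * Components of a natural transformation at isomorphic and composite proarrows *)

Section NatDiso.
Variables (E D : double_category) (G H : functor E D) (β : nattrans G H).

(** Naturality of [β] at the square [fwd u], whose top and bottom arrows are identities, so that the
    arrow components of [β] are trivial. *)
Lemma npro_diso (X Y : E) (r s : pro X Y) (u : diso r s) :
  fwd (npro β r)
  = (fwd (fdiso G u) ⊙⊙ hid (β Y)) » fwd (npro β s)
    » (hid (β X) ⊙⊙ bwd (fdiso H u)).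
Proof.
have e : (fwd (fdiso G u) ⊙⊙ hid (β Y)) » fwd (npro β s)
    = fwd (npro β r) » (hid (β X) ⊙⊙ fwd (fdiso H u)).
  apply: disk_eq; apply: heq4_trans (dcomp_heq _ _) _.
  apply: heq4_sym; apply: heq4_trans (dcomp_heq _ _) _.
  apply: heq4_trans (hcomp_heq (sq_refl _)
    (vcomp_heq (heq4_sym (narr_aid β X)) (fdisk_heq _ _))) _.
  apply: heq4_trans (heq4_sym (npro_nat β (fwd u))) _.
  apply: hcomp_heq (sq_refl _).
  exact: vcomp_heq (heq4_sym (fdisk_heq _ _)) (narr_aid β Y).
by rewrite dcompA e -dcompA -vcomp_dcompl fwdK vcomp_hid dcomp_idr.
Qed.

(** Strict functors preserve composites only up to propositional equality; this turns a
    heterogeneous equation into one between disks by inserting the transports. *)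
Lemma fwd_of_eq_heq (X Y X1 Y1 : D) (g g1 : pro X Y) (h h1 : pro X1 Y1)
    (b : pro X X1) (c : pro Y Y1) (eg : g = g1) (eh : h = h1)
    (i : diso (g ⊙ c) (b ⊙ h)) (j : diso (g1 ⊙ c) (b ⊙ h1)) :
  fwd i ≡ fwd j ->
  fwd i = (fwd (diso_of_eq eg) ⊙⊙ hid c) » fwd j
    » (hid b ⊙⊙ bwd (diso_of_eq eh)).
Proof.
case: g1 / eg j; case: h1 / eh => j /disk_eq ->.
by rewrite /= !vcomp_hid dcomp_idl dcomp_idr.
Qed.

Lemma npro_paste (X Y Z : E) (r : pro X Z) (p : pro X Y) (q : pro Y Z)
    (u : diso r (p ⊙ q)) :
  fwd (npro β r)
  = fwd (nat_paste (fdiso G u ;; diso_of_eq (fpro_pcomp G p q))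
           (npro β p) (npro β q)
           (fdiso H u ;; diso_of_eq (fpro_pcomp H p q))).
Proof.
rewrite (npro_diso u).
rewrite (fwd_of_eq_heq (fpro_pcomp G p q) (fpro_pcomp H p q) (npro_pcomp β p q)).
by rewrite /nat_paste !disoE vcomp_dcompl vcomp_dcompr -!dcompA.
Qed.

(** The component of [β] at [p ⊙ q] is computed twice: from its own factors, and through [u] from
    [p'] and [q']. *)
Lemma npro_interchange (X Y Y' Z : E) (p : pro X Y) (q : pro Y Z)
    (p' : pro X Y') (q' : pro Y' Z) (u : diso (p ⊙ q) (p' ⊙ q')) :
  fwd (nat_paste (diso_id _) (npro β p) (npro β q) (diso_id _))
  = fwd (nat_paste
      (diso_inv (diso_of_eq (fpro_pcomp G p q)) ;; fdiso G u
         ;; diso_of_eq (fpro_pcomp G p' q'))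
      (npro β p') (npro β q')
      (diso_inv (diso_of_eq (fpro_pcomp H p q)) ;; fdiso H u
         ;; diso_of_eq (fpro_pcomp H p' q'))).
Proof.
have := npro_paste u.
rewrite (fwd_of_eq_heq (fpro_pcomp G p q) (fpro_pcomp H p q) (npro_pcomp β p q)).
(* The transports at the two ends are cancelled by their inverses, which then appear in front of
   [fdiso G u] and [fdiso H u]. *)
move/(congr1 (fun x => (bwd (diso_of_eq (fpro_pcomp G p q)) ⊙⊙ hid (β Z))
  » x » (hid (β X) ⊙⊙ fwd (diso_of_eq (fpro_pcomp H p q))))).
rewrite -!dcompA -!vcomp_dcompl bwdK dcompA -vcomp_dcompr bwdK !vcomp_hid.
rewrite dcomp_idl dcomp_idr => e; rewrite /nat_paste !disoE !vcomp_hid.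
move: e; rewrite !disoE -!dcompA => e.
rewrite dcomp_idl dcomp_idr e.
by rewrite ?vcomp_dcompl ?vcomp_dcompr -?dcompA.
Qed.

End NatDiso.

Lemma fwd_comp_disk (D : double_category) (S P Q R P' Q' Q1 R1 Q1' : D)
    (f : pro S P) (a : pro P Q) (g : pro Q R)
    (f' : pro S P') (a' : pro P' Q') (g' : pro Q' R)
    (b : pro Q Q1) (c : pro R R1) (b' : pro Q' Q1')
    (h : pro Q1 R1) (h' : pro Q1' R1)
    (i i' : diso (f ⊙ a ⊙ g) (f' ⊙ a' ⊙ g'))
    (j : diso (g ⊙ c) (b ⊙ h)) (k : diso (g' ⊙ c) (b' ⊙ h')) :
  fwd i = fwd i' -> fwd (comp_disk i j k) = fwd (comp_disk i' j k).
Proof. by move=> e; rewrite /comp_disk !disoE e. Qed.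

(** * The composite dinatural transformation and its axioms *)

Section Composite.
Variables (C D : double_category) (F G H : difunctor C D).
Variables (α : dinat F G) (β : nattrans G H).

Definition comp_data : dinat_data F H :=
  @DinatData C D F H
    (fun A : C => dob α A ⊙ β (A, A))
    (fun (A B : C) (f : arr A B) => darr α f ⊙⊙ narr β (biarr f f))
    (fun (A B : C) (m : pro A B) =>
       comp_disk (dpro α m) (npro β (bipro m (punit B)))
         (npro β (bipro (punit A) m))).

Lemma comp_arr_aid (A : C) : darr comp_data (aid A) ≡ hid (dob comp_data A).
Proof.
rewrite /= -vcomp_hid; apply: vcomp_heq (darr_aid α A) _.
exact: (narr_aid β (A, A)).
Qed.

Lemma comp_arr_acomp (A B E : C) (f : arr A B) (g : arr B E) :
  darr comp_data (f · g) ≡ darr comp_data f ·· darr comp_data g.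
Proof.
rewrite /= -vcomp_hcomp; apply: vcomp_heq (darr_acomp α f g) _.
exact: (narr_acomp β (biarr f f) (biarr g g)).
Qed.

Lemma comp_pro_punit (A : C) :
  let c := lunit (dob comp_data A ⊙ punit (H (A, A)))
           ;; runit (dob comp_data A) in
  fwd (dpro comp_data (punit A))
  ≡ fwd (c ;; diso_id (dob comp_data A) ;; diso_inv c).
Proof.
have eF := fpro_punit F (A, A).
have eG := fpro_punit G (A, A).
have eH := fpro_punit H (A, A).
have K (X Y : D) (m n : pro X Y) (c : diso m n) :
  fwd (c ;; diso_id n ;; diso_inv c) = hid m.
  by rewrite !disoE dcomp_idr fwdK.
(* At a unit the two ends of the disk of [α] coincide, so it can be equated with an identity;
   strictness of [F] and [G] matches the boundaries. *)
have eα : fwd (dpro α (punit A)) = hid _.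
  apply: disk_eq; apply: heq4_trans (dpro_punit α A) _; rewrite K.
  by apply: hid_heq; rewrite -eF -eG.
move=> c; rewrite K (comp_disk_id (npro β (bipro (punit A) (punit A))) eα).
by apply: hid_heq; rewrite -eF -eH.
Qed.

Lemma comp_pro_pcomp (A B E : C) (m : pro A B) (n : pro B E) :
  fwd (dpro comp_data (m ⊙ n))
  = fwd (dinat_paste (split_cov F E m n) (split_contra H m n E)
           (dpro comp_data n) (interchange F n m) (interchange H m n)
           (dpro comp_data m) (split_contra F m n A) (split_cov H A m n)).
Proof.
rewrite -(comp_disk_paste (sG := split_contra G m n E)
  (iG := interchange G m n) (tG := split_cov G A m n)
  (jE := npro β (bipro (m ⊙ n) (punit E)))
  (jmE := npro β (bipro m (punit E))) (jAn := npro β (bipro (punit A) n))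
  (jA := npro β (bipro (punit A) (m ⊙ n))) _ _ _ _ _).
- exact: npro_paste.
- exact: npro_paste.
- exact: npro_interchange.
- apply: fwd_comp_disk; apply: disk_eq; exact: (dpro_pcomp α m n).
Qed.

Lemma comp_pro_nat (A B P Q : C) (m : pro A P) (n : pro B Q)
    (f : arr A B) (g : arr P Q) (φ : sq m n f g) :
  (fsq F (bisq (vunit g) φ)
     ⊙⊙ darr comp_data g ⊙⊙ fsq H (bisq φ (vunit g)))
    ·· fwd (dpro comp_data n)
  ≡ fwd (dpro comp_data m)
    ·· (fsq F (bisq φ (vunit f))
          ⊙⊙ darr comp_data f ⊙⊙ fsq H (bisq (vunit f) φ)).
Proof.
(* The squares on the intermediate proarrows G(m, P), G(A, m) and β(A, P) do not occur in the goal
   and have to be supplied. *)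
apply: (natural_comp_disk (φg := fsq G (bisq φ (vunit g)))
  (φg1 := fsq G (bisq (vunit f) φ)) (φc := narr β (biarr f g))).
- exact: (dpro_nat α φ).
- exact: (npro_nat β (bisq φ (vunit g))).
- exact: (npro_nat β (bisq (vunit f) φ)).
Qed.

(** Left transparent so that its cells reduce to [comp_data]. *)
Definition comp_dinat : dinat F H.
Proof.
apply: (@Dinat C D F H comp_data).
- exact: comp_arr_aid.
- exact: comp_arr_acomp.
- exact: comp_pro_punit.
- by move=> A B E m n; rewrite comp_pro_pcomp; apply: sq_refl.
- exact: comp_pro_nat.
Defined.

End Composite.

Theorem proposition3p9 (C D : double_category) (F G H : difunctor C D)
    (α : dinat F G) (β : nattrans G H) :
  exists γ : dinat F H,
    dinat_cells γ =
    @DinatData C D F H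
      (fun A : C => dob α A ⊙ β (A, A))
      (fun (A B : C) (f : arr A B) => darr α f ⊙⊙ narr β (biarr f f))
      (fun (A B : C) (m : pro A B) =>
         (diso_id (fpro F (bipro (punit B) m))
            ⊗ assoc (dob α B) (β (B, B)) (fpro H (bipro m (punit B))))
         ;; (diso_id (fpro F (bipro (punit B) m))
               ⊗ (diso_id (dob α B)
                    ⊗ diso_inv (npro β (bipro m (punit B)))))
         ;; (diso_id (fpro F (bipro (punit B) m))
               ⊗ diso_inv (assoc (dob α B)
                             (fpro G (bipro m (punit B))) (β (A, B))))
         ;; diso_inv (assoc (fpro F (bipro (punit B) m))
                        (dob α B ⊙ fpro G (bipro m (punit B))) (β (A, B)))
         ;; (dpro α m ⊗ diso_id (β (A, B)))
         ;; assoc (fpro F (bipro m (punit A)))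
                  (dob α A ⊙ fpro G (bipro (punit A) m)) (β (A, B))
         ;; (diso_id (fpro F (bipro m (punit A)))
               ⊗ assoc (dob α A) (fpro G (bipro (punit A) m)) (β (A, B)))
         ;; (diso_id (fpro F (bipro m (punit A)))
               ⊗ (diso_id (dob α A) ⊗ npro β (bipro (punit A) m)))
         ;; (diso_id (fpro F (bipro m (punit A)))
               ⊗ diso_inv (assoc (dob α A) (β (A, A))
                             (fpro H (bipro (punit A) m))))).
(* The cells agree by conversion: [comp_disk] unfolds to the displayed pasting. *)
Proof. by exists (comp_dinat α β). Qed.
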